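(* For $t\in\mathbb{C}$ let $B_t(x,y)=x^6+tx^3y^3+y^6$. A binary sextic form $p\in\mathbb{C}[x,y]$ has $N(p)=3$ if and only if $p$ is similar to $B_t$ for some $t\in\mathbb{C}\setminus\{2,-2,0,5\sqrt{-2},-5\sqrt{-2}\}$. Moreover $N(B_{\pm2})=0$, $N(B_0)=4$ and $N(B_{\pm5\sqrt{-2}})=6$.
   Context: Two forms $p,p'\in\mathbb{C}[x,y]$ are similar if $p'=p\circ M$ for some invertible linear change $M(x,y)=(\alpha x+\beta y,\gamma x+\delta y)$, $\alpha\delta-\beta\gamma\ne0$. For a binary sextic $p$, $N(p)$ is the number of representations $p=f_1^3+f_2^3$ with $f_1,f_2\in\mathbb{C}[x,y]$ non-proportional quadratic forms, where two representations are counted as the same if the unordered pairs $\{f_1^3,f_2^3\}$ coincide. *)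

(* Defs.v *)
(* The complex numbers are R[i] for R a realType, and binary
   forms are homogeneous elements of {mpoly R[i][2]}. *)
From mathcomp Require Import all_boot all_order all_algebra finmap.
From mathcomp Require Import classical_sets functions cardinality reals.
From mathcomp Require Import complex mpoly.

Set Implicit Arguments.
Unset Strict Implicit.
Unset Printing Implicit Defensive.

Import Order.TTheory GRing.Theory Num.Theory.

Local Open Scope ring_scope.
Local Open Scope classical_set_scope.

Section BinaryForms.
Variable R : realType.
Implicit Types p q f g : {mpoly R[i][2]}.

Definition xvar : {mpoly R[i][2]} := 'X_ord0.
Definition yvar : {mpoly R[i][2]} := 'X_ord_max.

Definition lin_change (a b c d : R[i]) p : {mpoly R[i][2]} :=
  p \mPo [tuple a *: xvar + b *: yvar; c *: xvar + d *: yvar].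

Definition similar_forms p q : Prop :=
  exists a b c d : R[i], a * d - b * c != 0 /\ q = lin_change a b c d p.

Definition proportional f g : Prop :=
  exists a b : R[i], (a != 0 \/ b != 0) /\ a *: f + b *: g = 0.

(* A representation p = f^3 + g^3 is recorded by the unordered pair
   {f^3, g^3}, so that choices of f and g with the same cubes, in either
   order, count once. *)
Definition representations p : set {fset {mpoly R[i][2]}} :=
  [set S | exists f g, [/\ f \is 2.-homog, g \is 2.-homog,
     ~ proportional f g, p = f ^+ 3 + g ^+ 3 & S = [fset f ^+ 3; g ^+ 3]%fset]].

(* N(p) = k: a relation rather than a function, so that an infinite set of
   representations has no (default) natural number as its cardinality. *)
Definition N_is p (k : nat) : Prop := (representations p #= `I_k)%card.

Definition B (t : R[i]) : {mpoly R[i][2]} :=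
  xvar ^+ 6 + t *: (xvar ^+ 3 * yvar ^+ 3) + yvar ^+ 6.

End BinaryForms.

(* Main.v *)
(* If p = f^3 + g^3, the pencil spanned by f and g is the set of quadratic forms
   orthogonal to the coefficient vector n of the cross product f x g.  To n is
   attached the traceless matrix M_n, acting on the line as an involution, which
   multiplies every form of the pencil by delta(n) = - det M_n; hence
   p o M_n = delta(n)^3 p.  The pencil determines the unordered pair
   {f^3, g^3}, so representations of p are counted by involutions.

   If p has no double root, let M and M' come from two different
   representations.  Triangularizing M M' and comparing coefficients of p shows
   that M M' acts on the line with order 3 or 2.  Order 3 forces p to be
   e6 x^6 + e3 x^3 y^3 + e0 y^6 in suitable coordinates, which is similar to
   some B_t.  Three representations cannot give three pairwise commuting
   involutions: the third would be proportional to M M', for which p has the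
   opposite sign.  If p has a double root, its coefficients there determine n,
   so p has at most one representation.

   For B_t itself with t^2 <> 4, the three involutions x <-> z y with z^3 = 1
   are always there.  If M_n is another one, the traces of its products with
   these three are each 0 or a square root of delta(n) by the above, and their
   sum is 0; this leaves only x -> - x (t = 0) and three involutions of the
   octahedral group (t^2 = - 50).  Each of these comes from an explicit
   representation. *)
Require Import Defs.
From mathcomp Require Import all_boot all_order all_algebra finmap.
From mathcomp Require Import classical_sets functions cardinality reals.
From mathcomp Require Import complex mpoly.
From mathcomp Require Import boolp ring.
Import Order.TTheory GRing.Theory Num.Theory.
Set Implicit Arguments.
Unset Strict Implicit.
Unset Printing Implicit Defensive.
Local Open Scope ring_scope.

(** * Linear combinations of equations and cube roots of unity *)

Section LinearCombination.
Variable K : comPzRingType.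
Implicit Types a b k x y : K.

(** Here and in [lincomb2] an equation is derived from known ones through explicit cofactors; what
    remains is a polynomial identity for [ring] or [field]. *)
Lemma lincomb1 k a b x y : a = b -> x - y = k * (a - b) -> x = y.
Proof. by move=> ->; rewrite subrr mulr0 => /eqP; rewrite subr_eq0 => /eqP. Qed.

Lemma lincomb2 k1 a1 b1 k2 a2 b2 x y : a1 = b1 -> a2 = b2 ->
  x - y = k1 * (a1 - b1) + k2 * (a2 - b2) -> x = y.
Proof.
move=> -> ->; rewrite !subrr !mulr0 addr0 => /eqP.
by rewrite subr_eq0 => /eqP.
Qed.

End LinearCombination.

Section CubeRoots.
Variable C : numClosedFieldType.
Implicit Types z w : C.

Lemma cube_root_of_unity_neq0 (z : C) : z ^+ 3 = 1 -> z != 0.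
Proof. by apply: contra_eq_neq => ->; rewrite expr0n eq_sym oner_eq0. Qed.

Lemma cube_roots_of_unity : exists o : C, [/\ o ^+ 2 + o + 1 = 0, o ^+ 3 = 1 &
  pairwise (fun z w => z != w) [:: 1; o; o ^+ 2]].
Proof.
pose o : C := (sqrtC (- 3) - 1) / 2.
have s3 : sqrtC (- 3 : C) ^+ 2 = - 3 by rewrite sqrtCK.
have oE : o ^+ 2 + o + 1 = 0.
  by apply: (@lincomb1 _ (1 / 4) _ _ _ _ s3); rewrite /o; field.
have o3 : o ^+ 3 = 1 by apply: (@lincomb1 _ (o - 1) _ _ _ _ oE); ring.
have o1 : 1 != o.
  apply: contra_eq_neq oE => <-.
  by rewrite expr1n (_ : 1 + 1 + 1 = 3%:R) ?pnatr_eq0 //; ring.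
have o0 : o != 0 by apply: contra_eq_neq o3 => ->;
  rewrite expr0n eq_sym oner_eq0.
exists o; split=> //=; rewrite !andbT o1 /=; apply/andP; split.
  apply: contra_neq o1 => e; apply: (mulIf (expf_neq0 2 o0)).
  by rewrite -exprS o3 mul1r -e.
by apply: contra_neq o1 => e; apply: (mulfI o0); rewrite mulr1 -expr2.
Qed.

Lemma cube_root_of_unityP (o z : C) : o ^+ 2 + o + 1 = 0 -> z ^+ 3 = 1 ->
  z \in [:: 1; o; o ^+ 2].
Proof.
move=> oE z3; rewrite !inE.
have /eqP : (z - 1) * ((z - o) * (z - o ^+ 2)) = 0.
  by apply: (@lincomb2 _ 1 _ _ (- z ^+ 2 + z * o - (o - 1)) _ _ _ _ z3 oE);
    ring.
by rewrite !mulf_eq0 !subr_eq0.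
Qed.

Lemma eq_sqr (u v : C) : u ^+ 2 = v ^+ 2 -> u = v \/ u = - v.
Proof. by move/eqP; rewrite eqf_sqr => /orP[] /eqP; [left|right]. Qed.

End CubeRoots.

(** * Involutions preserving a binary sextic *)

Section Core.
Variable C : numClosedFieldType.
Implicit Types (n m f g w : C * C * C) (P : C -> C -> C) (c : nat -> C).

(* The coefficient of x^i has index i. *)
Definition bform (d : nat) c (x y : C) : C :=
  \sum_(i < d.+1) c i * x ^+ i * y ^+ (d - i).

Lemma bform_inj d c c' : (forall x y, bform d c x y = bform d c' x y) ->
  forall i, (i <= d)%N -> c i = c' i.
Proof.
move=> eqF; pose q := \poly_(i < d.+1) (c i - c' i).
have q0 x : q.[x] = 0.
  have /eqP := eqF x 1; rewrite -subr_eq0 -sumrB => /eqP E.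
  rewrite horner_poly -[RHS]E; apply: eq_bigr => i _.
  by rewrite !expr1n !mulr1 mulrBl.
have qE : q = 0.
  (* The points 0, ..., d + 1 are distinct in characteristic 0 and outnumber the degree of [q],
     which is at most d. *)
  apply: (@roots_geq_poly_eq0 _ q [seq i%:R | i <- iota 0 d.+2]).
  - by apply/allP => z _; rewrite rootE q0.
  - rewrite map_inj_uniq ?iota_uniq // => i j /eqP.
    by rewrite eqr_nat => /eqP.
  - by rewrite size_map size_iota (leq_trans (size_poly _ _)).
move=> i; rewrite -ltnS => ltid; apply/eqP; rewrite -subr_eq0; apply/eqP.
by have := congr1 (fun r : {poly C} => r`_i) qE; rewrite coef_poly ltid coef0.
Qed.

Lemma bform6E c x y : bform 6 c x y =
  c 0%N * y ^+ 6 + c 1%N * x * y ^+ 5 + c 2%N * x ^+ 2 * y ^+ 4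
  + c 3%N * x ^+ 3 * y ^+ 3 + c 4%N * x ^+ 4 * y ^+ 2 + c 5%N * x ^+ 5 * y
  + c 6%N * x ^+ 6.
Proof. by rewrite /bform !big_ord_recl big_ord0 /=; ring. Qed.

Definition cross f g : C * C * C :=
  (f.1.2 * g.2 - f.2 * g.1.2, f.2 * g.1.1 - f.1.1 * g.2,
   f.1.1 * g.1.2 - f.1.2 * g.1.1).

Definition dot f g : C := f.1.1 * g.1.1 + f.1.2 * g.1.2 + f.2 * g.2.

Definition scale3 k f : C * C * C := (k * f.1.1, k * f.1.2, k * f.2).

(* Quadratic forms are listed from x^2 to y^2, in the order opposite to bform. *)
Definition qform f (x y : C) : C := f.1.1 * x ^+ 2 + f.1.2 * x * y + f.2 * y ^+
  2.

(* To n = (n0, n1, n2) is attached the matrix M_n with rows (n1, - n0) and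
   (n2, - n1): delta n = - det M_n and tau n m = tr (M_n M_m). *)
Definition delta n : C := n.1.2 ^+ 2 - n.1.1 * n.2.

Definition tau n m : C := 2 * n.1.2 * m.1.2 - n.1.1 * m.2 - n.2 * m.1.1.

Definition involution_invariant P n := forall x y,
  P (n.1.2 * x - n.1.1 * y) (n.2 * x - n.1.2 * y) = delta n ^+ 3 * P x y.

Lemma triple_neq0P n : n != 0 -> [|| n.1.1 != 0, n.1.2 != 0 | n.2 != 0].
Proof.
case: n => [[n0 n1] n2] /=; apply: contraNT; rewrite !negb_or !negbK.
by case/and3P=> /eqP -> /eqP -> /eqP ->.
Qed.

(** * Cross products and proportionality of coefficient vectors *)

Lemma cross_eq0P f g : cross f g = 0 ->
  [/\ f.1.2 * g.2 = f.2 * g.1.2, f.2 * g.1.1 = f.1.1 * g.2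
    & f.1.1 * g.1.2 = f.1.2 * g.1.1].
Proof. by case=> /subr0_eq h0 /subr0_eq h1 /subr0_eq h2. Qed.

Lemma cross_prop n m : n != 0 -> cross n m = 0 -> exists k, m = scale3 k n.
Proof.
move=> /triple_neq0P; case: n m => [[n0 n1] n2] [[m0 m1] m2] /=.
move=> nN0 /cross_eq0P[/= h0 h1 h2].
case/or3P: nN0 => nz; [exists (m0 / n0) | exists (m1 / n1) | exists (m2 / n2)];
  rewrite /scale3 /=; (congr (_, _, _); apply: (mulfI nz)).
- by field.
- by rewrite h2; field.
- by rewrite -h1; field.
- by rewrite -h2; field.
- by field.
- by rewrite h0; field.
- by rewrite h1; field.
- by rewrite -h0; field.
- by field.
Qed.

Lemma crossC0 n m : cross n m = 0 -> cross m n = 0.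
Proof.
case/cross_eq0P=> h0 h1 h2; congr (_, _, _) => /=.
- by apply: (@lincomb1 _ (-1) _ _ _ _ h0); ring.
- by apply: (@lincomb1 _ (-1) _ _ _ _ h1); ring.
- by apply: (@lincomb1 _ (-1) _ _ _ _ h2); ring.
Qed.

(** Triple product identity: (f x g) x w = (f . w) g - (g . w) f. *)
Lemma orth_cross f g w : dot f w = 0 -> dot g w = 0 -> cross (cross f g) w = 0.
Proof.
case: f g w => [[f0 f1] f2] [[g0 g1] g2] [[w0 w1] w2]; rewrite /dot /= => hf hg.
congr (_, _, _); rewrite /=.
- by apply: (@lincomb2 _ (-f0) _ _ g0 _ _ _ _ hg hf); ring.
- by apply: (@lincomb2 _ (-f1) _ _ g1 _ _ _ _ hg hf); ring.
- by apply: (@lincomb2 _ (-f2) _ _ g2 _ _ _ _ hg hf); ring.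
Qed.

Lemma dot_cross f g : dot f (cross f g) = 0 /\ dot g (cross f g) = 0.
Proof. by rewrite /dot /=; split; ring. Qed.

(** The two sides differ by [dot f n] times the quadratic form n2 x^2 - 2 n1 x y + n0 y^2, whose
    zeros are the fixed points of M_n. *)
Lemma qform_invol n f x y : dot f n = 0 ->
  qform f (n.1.2 * x - n.1.1 * y) (n.2 * x - n.1.2 * y) = delta n * qform f x y.
Proof.
rewrite /dot /qform /delta => h.
by apply: (@lincomb1 _ (n.2 * x ^+ 2 - 2 * n.1.2 * x * y + n.1.1 * y ^+
  2) _ _ _ _ h); ring.
Qed.

(** The vector v is an eigenvector for l, and w is one for u modulo v. The last clause leaves either
    a diagonal matrix or a repeated eigenvalue. *)
Lemma triangularize (p q r s : C) : exists l u k v1 v2 w1 w2 : C,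
  [/\ v1 * w2 - v2 * w1 != 0, l + u = p + s /\ l * u = p * s - q * r,
      p * v1 + q * v2 = l * v1 /\ r * v1 + s * v2 = l * v2,
      p * w1 + q * w2 = u * w1 + k * v1 /\ r * w1 + s * w2 = u * w2 + k * v2
    & l = u \/ k = 0].
Proof.
have two : (2 : C) != 0 by rewrite pnatr_eq0.
(* A square root of the discriminant of the characteristic polynomial. *)
pose D := sqrtC ((p + s) ^+ 2 - 4 * (p * s - q * r)).
have D2 : D ^+ 2 = (p + s) ^+ 2 - 4 * (p * s - q * r) by rewrite sqrtCK.
pose l := (p + s + D) / 2; pose u := (p + s - D) / 2.
have lu : l + u = p + s by rewrite /l /u; field.
have pu : l * u = p * s - q * r.
  by apply: (@lincomb1 _ (-1/4) _ _ _ _ D2); rewrite /l /u; field.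
have lE : s = l + u - p by rewrite lu; ring.
have [q0|qN] := eqVneq q 0.
  have [r0|rN] := eqVneq r 0.
    exists p, s, 0, 1, 0, 0, 1; rewrite q0 r0.
    split; first by rewrite mulr1 mulr0 subr0 oner_neq0.
    - by split; ring.
    - by split; ring.
    - by split; ring.
    - by right.
  have rE : p = l + u - s by rewrite lu; ring.
  have [e|ne] := eqVneq l u.
    exists l, u, 1, (l - s), r, 1, 0; split; try (by left); try (by split).
    - by rewrite mulr0 mulr1 sub0r oppr_eq0.
    - split; last ring.
      by apply: (@lincomb2 _ 1 _ _ l _ _ _ _ pu (esym lu)); rewrite ?q0; ring.
    - by split; rewrite ?rE; ring.
  exists l, u, 0, (l - s), r, (u - s), r; split; try (by right); try (by split).
  - rewrite (_ : _ - _ = r * (l - u)); last ring.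
    by rewrite mulf_neq0 // subr_eq0.
  - split; last ring.
    by apply: (@lincomb2 _ 1 _ _ l _ _ _ _ pu (esym lu)); rewrite ?q0; ring.
  - split; last ring.
    by apply: (@lincomb2 _ 1 _ _ u _ _ _ _ pu (esym lu)); rewrite ?q0; ring.
(* The first row gives the eigenvector (q, l - p); above, with q = 0, the second row gave (l - s,
   r). *)
have [e|ne] := eqVneq l u.
  exists l, u, 1, q, (l - p), 0, 1; split; try (by left); try (by split).
  - by rewrite mulr0 mulr1 subr0.
  - split; first ring.
    by apply: (@lincomb2 _ 1 _ _ l _ _ _ _ pu (esym lu)); ring.
  - by split; rewrite ?lE; ring.
exists l, u, 0, q, (l - p), q, (u - p); split; try (by right); try (by split).
- rewrite (_ : _ - _ = q * (u - l)); last ring.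
  by rewrite mulf_neq0 // subr_eq0 eq_sym.
- split; first ring.
  by apply: (@lincomb2 _ 1 _ _ l _ _ _ _ pu (esym lu)); ring.
- split; first ring.
  by apply: (@lincomb2 _ 1 _ _ u _ _ _ _ pu (esym lu)); ring.
Qed.

(** Forms are functions here, so that [Bt t] and evaluated polynomials are treated alike.
    Quantifying over all substitutions makes coefficients available in any coordinates. *)
Definition sextic P := forall a b c d : C, exists e : nat -> C,
  forall x y, P (a * x + b * y) (c * x + d * y) = bform 6 e x y.

(* (0, 1) is moved to an arbitrary point of the line by the change of
   coordinates. *)
Definition no_double_root P := forall (a b c d : C) (e : nat -> C),
  a * d - b * c != 0 ->
  (forall x y, P (a * x + b * y) (c * x + d * y) = bform 6 e x y) ->
  (e 0%N != 0) || (e 1%N != 0).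

Lemma bform6_eq c c' : (forall x y, bform 6 c x y = bform 6 c' x y) ->
  [/\ c 0%N = c' 0%N, c 1%N = c' 1%N, c 2 = c' 2 & c 3 = c' 3] /\
  [/\ c 4 = c' 4, c 5 = c' 5 & c 6 = c' 6].
Proof. by move=> /bform_inj h; split; split; apply: h. Qed.

(* A sextic invariant under a shear fixing (0, 1) has a double root there. *)
Lemma shear_coef c l k : l != 0 -> k != 0 ->
  (forall x y, bform 6 c (l * x) (k * x + l * y) = l ^+ 6 * bform 6 c x y) ->
  c 0%N = 0 /\ c 1%N = 0.
Proof.
move=> l0 k0 H.
pose c' := nth 0 [:: l ^+ 6 * c 0%N; l ^+ 6 * c 1%N + 6 * c 0%N * k * l ^+ 5;
  l ^+ 6 * c 2 + 15 * c 0%N * k ^+ 2 * l ^+ 4 + 5 * c 1%N * k * l ^+ 5;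
  20 * c 0%N * k ^+ 3 * l ^+ 3 + 10 * c 1%N * k ^+ 2 * l ^+ 4 +
    4 * c 2 * k * l ^+ 5
    + c 3 * l ^+ 6;
  15 * c 0%N * k ^+ 4 * l ^+ 2 + 10 * c 1%N * k ^+ 3 * l ^+ 3 + 6 * c 2 * k ^+
    2 * l ^+ 4
    + 3 * c 3 * k * l ^+ 5 + c 4 * l ^+ 6;
  6 * c 0%N * k ^+ 5 * l + 5 * c 1%N * k ^+ 4 * l ^+ 2 + 4 * c 2 * k ^+
    3 * l ^+ 3
    + 3 * c 3 * k ^+ 2 * l ^+ 4 + 2 * c 4 * k * l ^+ 5 + c 5 * l ^+ 6;
  c 0%N * k ^+ 6 + c 1%N * k ^+ 5 * l + c 2 * k ^+ 4 * l ^+ 2 + c 3 * k ^+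
    3 * l ^+ 3
    + c 4 * k ^+ 2 * l ^+ 4 + c 5 * k * l ^+ 5 + c 6 * l ^+ 6].
have /bform6_eq [[_ h1 h2 _] _] : forall x y, bform 6 c' x y = bform 6 (fun i
  => l ^+ 6 * c i) x y.
  move=> x y; rewrite [RHS](_ : _ = l ^+ 6 * bform 6 c x y); last first.
    by rewrite !bform6E; ring.
  by rewrite -H !bform6E /c' /=; ring.
(* The coefficient of x y^5 gives 6 c_0 k l^5 = 0; then that of x^2 y^4 gives 5 c_1 k l^5 = 0. *)
have nz z : (z.+1%:R : C) * k * l ^+ 5 != 0.
  by rewrite !mulf_neq0 ?expf_neq0 // pnatr_eq0.
have c0 : c 0%N = 0.
  apply/(mulfI (nz 5)); rewrite mulr0; move: h1; rewrite /c' /= => /eqP.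
  by rewrite -subr_eq0 => /eqP <-; ring.
split=> //; apply/(mulfI (nz 4)); rewrite mulr0; move: h2; rewrite /c' /= c0
  => /eqP.
by rewrite -subr_eq0 => /eqP <-; ring.
Qed.

(** A diagonal substitution acts on each monomial by a scalar, so every monomial that occurs must
    carry the multiplier of the whole form. *)
Lemma diag_coef c l u :
  (forall x y, bform 6 c (u * x) (l * y) = (l * u) ^+ 3 * bform 6 c x y) ->
  forall i, (i <= 6)%N -> c i != 0 -> u ^+ i * l ^+ (6 - i) = (l * u) ^+ 3.
Proof.
move=> H i lei ci0.
have E : forall x y, bform 6 (fun i => (u ^+ i * l ^+ (6 - i)) * c i) x y
   = bform 6 (fun i => (l * u) ^+ 3 * c i) x y.
  move=> x y; transitivity (bform 6 c (u * x) (l * y)).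
    by apply: eq_bigr => j _; rewrite !exprMn; ring.
  by rewrite H /bform mulr_sumr; apply: eq_bigr => j _; rewrite !mulrA.
by have /(mulIf ci0) := bform_inj E lei.
Qed.

Lemma no_double_root_swap P (a b c d : C) (e : nat -> C) : no_double_root P
  -> a * d - b * c != 0 ->
  (forall x y, P (a * x + b * y) (c * x + d * y) = bform 6 e x y) ->
  (e 6 != 0) || (e 5 != 0).
Proof.
move=> nP D0 H.
apply: (nP b a d c (fun i => e (6 - i)%N)) => [|x y].
  by rewrite (_ : b * c - a * d = - (a * d - b * c)) ?oppr_eq0 //; ring.
by rewrite addrC [d * x + _]addrC H !bform6E /=; ring.
Qed.

Lemma involution_invariant_mul P n m : involution_invariant P n
  -> involution_invariant P m -> forall x y,
  P ((n.1.2 * m.1.2 - n.1.1 * m.2) * x + (n.1.1 * m.1.2 - n.1.2 * m.1.1) * y)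
    ((n.2 * m.1.2 - n.1.2 * m.2) * x + (n.1.2 * m.1.2 - n.2 * m.1.1) * y)
  = (delta n * delta m) ^+ 3 * P x y.
Proof.
by move=> hn hm x y; rewrite exprMn -mulrA -hm -hn; congr P; ring.
Qed.

(** Let l, u be the eigenvalues of M_n M_m. A Jordan block would create a double root, and a scalar
    matrix would make n and m parallel. In eigencoordinates a coefficient e_i can survive only if
    u^i l^(6-i) = (l u)^3. This kills e_2 and e_4; e_1 or e_5 forces u = - l, hence trace 0.
    Otherwise e_0 and e_6 are nonzero and l^3 = u^3 with l <> u, so (l + u)^2 = l u. *)
Lemma two_involutions P n m : sextic P -> no_double_root P ->
  delta n != 0 -> delta m != 0 -> involution_invariant P n
    -> involution_invariant P m ->
  cross n m != 0 ->
  tau n m = 0 \/ tau n m ^+ 2 = delta n * delta m /\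
    exists a b c d e0 e3 e6 : C, [/\ a * d - b * c != 0, e0 != 0, e6 != 0 &
      forall x y, P (a * x + b * y) (c * x + d * y) =
        e0 * y ^+ 6 + e3 * x ^+ 3 * y ^+ 3 + e6 * x ^+ 6].
Proof.
move=> sP nP dn dm hn hm ncross.
have := involution_invariant_mul hn hm.
set p := _ - _ * m.2; set q := _ - _ * m.1.1; set r := _ - n.1.2 * _.
set s := n.1.2 * _ - n.2 * _ => PT.
have [l [u [k [v1 [v2 [w1 [w2 [D0 [tr dt] [V1 V2] [W1 W2] luk]]]]]]]] :=
  triangularize p q r s.
have trE : tau n m = l + u by rewrite tr /tau /p /s; ring.
have dtE : delta n * delta m = l * u by rewrite dt /delta /p /q /r /s; ring.
have [l0 u0] : l != 0 /\ u != 0.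
  by apply/andP; rewrite -negb_or -mulf_eq0 -dtE mulf_neq0.
(* The eigenvector v is placed at (0, 1) and w at (1, 0), so M_n M_m becomes (x, y) -> (u x, k x + l
   y). *)
have [e He] := sP w1 v1 w2 v2.
have D0' : w1 * v2 - v1 * w2 != 0.
  by rewrite (_ : w1 * v2 - v1 * w2 = - (v1 * w2 - v2 * w1)) ?oppr_eq0 //; ring.
have eT x y : bform 6 e (u * x) (k * x + l * y) = (l * u) ^+ 3 * bform 6 e x y.
  rewrite -!He -dtE -PT; congr P.
    rewrite (_ : p * _ + _ = x * (p * w1 + q * w2) + y * (p * v1 + q * v2));
      last ring.
    by rewrite W1 V1; ring.
  rewrite (_ : r * _ + _ = x * (r * w1 + s * w2) + y * (r * v1 + s * v2));
    last ring.
  by rewrite W2 V2; ring.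
have e01 := nP _ _ _ _ _ D0' He.
have e56 := no_double_root_swap nP D0' He.
have [k0|kN] := eqVneq k 0; last first.
  case: luk => [lu|k0]; last by rewrite k0 eqxx in kN.
  case: (@shear_coef e l k l0 kN) => [x y|e0 e1]; last
    by rewrite e0 e1 eqxx in e01.
  by move: (eT x y); rewrite -lu => ->; ring.
(* If l = u, then M_n M_m is scalar; up to sign, r, p - s and q are the coordinates of
   [cross n m]. *)
have [lu|lNu] := eqVneq l u.
  case/eqP: ncross; rewrite k0 -lu !mul0r !addr0 in W1 W2.
  have E1 : q = 0.
    apply: (mulfI D0); rewrite mulr0.
    by apply: (@lincomb2 _ (-w1) _ _ v1 _ _ _ _ V1 W1); ring.
  have E2 : r = 0.
    apply: (mulfI D0); rewrite mulr0.
    by apply: (@lincomb2 _ (w2) _ _ (-v2) _ _ _ _ V2 W2); ring.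
  have E3 : p - s = 0.
    apply: (mulfI D0); rewrite mulr0.
    have h1 := lincomb2 (k1 := w2) (k2 := -v2) V1 W1.
    have h2 := lincomb2 (k1 := w1) (k2 := -v1) V2 W2.
    have P1 : p * (v1 * w2 - v2 * w1) = l * (v1 * w2 - v2 * w1) by apply: h1;
      ring.
    have P2 : s * (v2 * w1 - v1 * w2) = l * (v2 * w1 - v1 * w2) by apply: h2;
      ring.
    by apply: (@lincomb2 _ 1 _ _ 1 _ _ _ _ P1 P2); ring.
  congr (_, _, _).
  - by rewrite -[RHS]oppr0 -E2 /r; ring.
  - by rewrite -E3 /p /s; ring.
  - by rewrite -E1 /q; ring.
have dg : forall i, (i <= 6)%N -> e i != 0 -> u ^+ i * l ^+ (6 - i) =
  (l * u) ^+ 3.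
  by apply: diag_coef => x y; rewrite -eT k0 mul0r add0r.
have luD : l - u != 0 by rewrite subr_eq0.
have anti : u ^+ 2 = l ^+ 2 -> tau n m = 0.
  move=> h; rewrite trE; apply: (mulfI luD); rewrite mulr0.
  by apply: (@lincomb1 _ (-1) _ _ _ _ h); ring.
have d1 : e 1%N != 0 -> u ^+ 2 = l ^+ 2.
  move=> /(dg 1%N erefl) /= h; apply: (mulfI (expf_neq0 3 l0));
    apply: (mulfI u0).
  by apply: (@lincomb1 _ (-1) _ _ _ _ h); ring.
have d5 : e 5%N != 0 -> u ^+ 2 = l ^+ 2.
  move=> /(dg 5%N erefl) /= h; apply: (mulfI (expf_neq0 3 u0));
    apply: (mulfI l0).
  by apply: (@lincomb1 _ 1 _ _ _ _ h); ring.
have d2 : e 2 = 0.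
  apply/eqP; apply: contraTT (lNu) => /(dg 2 erefl) /= h; rewrite negbK;
    apply/eqP.
  apply: (mulfI (expf_neq0 3 l0)); apply: (mulfI (expf_neq0 2 u0)).
  by apply: (@lincomb1 _ 1 _ _ _ _ h); ring.
have d4 : e 4 = 0.
  apply/eqP; apply: contraTT (lNu) => /(dg 4 erefl) /= h; rewrite negbK;
    apply/eqP.
  apply: (mulfI (expf_neq0 3 u0)); apply: (mulfI (expf_neq0 2 l0)).
  by apply: (@lincomb1 _ (-1) _ _ _ _ h); ring.
have [e1|/d1/anti] := eqVneq (e 1%N) 0; last by left.
have [e5|/d5/anti] := eqVneq (e 5%N) 0; last by left.
rewrite e1 e5 eqxx !orbF in e01 e56; right; split.
  have /= h := dg 0%N erefl e01; rewrite trE dtE.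
  apply: (mulfI luD); apply: (mulfI (expf_neq0 3 l0)).
  by apply: (@lincomb1 _ 1 _ _ _ _ h); ring.
exists w1, v1, w2, v2, (e 0%N), (e 3), (e 6); split=> // x y.
by rewrite He bform6E e1 e5 d2 d4; ring.
Qed.

(** As [tau n m = 0], the product M_n M_m is a traceless M_t, and w is orthogonal to n and m for the
    trace form, so w = k t. Invariance under M_w then has multiplier - k^6 (delta n delta m)^3,
    while M_n M_m gives the same with a plus sign. *)
Lemma three_commuting P n m w : involution_invariant P n
  -> involution_invariant P m -> involution_invariant P w ->
  delta n != 0 -> delta m != 0 -> delta w != 0 ->
  (forall k x y, P (k * x) (k * y) = k ^+ 6 * P x y) ->
  tau n m = 0 -> tau n w = 0 -> tau m w = 0 -> forall x y, P x y = 0.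
Proof.
move=> hn hm hw dn dm dw homP nm nw mw x y.
have two : (2 : C) != 0 by rewrite pnatr_eq0.
pose t : C * C * C := (n.1.2 * m.1.1 - n.1.1 * m.1.2,
  n.1.2 * m.1.2 - n.1.1 * m.2,
  n.2 * m.1.2 - n.1.2 * m.2).
(* This twist turns the trace form into the dot product, so that [orth_cross] applies. *)
pose tw f : C * C * C := (- f.2, 2 * f.1.2, - f.1.1).
have tnm : cross (tw n) (tw m) = scale3 (-2) t.
  rewrite /cross /tw /scale3 /t /=; congr (_, _, _); [ring| |ring].
  by apply: (@lincomb1 _ 1 _ _ _ _ nm); rewrite /tau; ring.
have dt : delta t = - (delta n * delta m).
  rewrite /delta /t /=.
  by apply: (@lincomb1 _ (n.1.2 * m.1.2 - n.1.1 * m.2) _ _ _ _ nm);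
    rewrite /tau; ring.
have t0 : t != 0.
  apply/eqP => tE; move: dt; rewrite tE /delta /= mulr0 expr0n subr0 => /eqP.
  by rewrite eq_sym oppr_eq0 mulf_eq0 (negPf dn) (negPf dm).
have twE f : tau f w = dot (tw f) w by rewrite /tau /dot /tw /=; ring.
have ct : cross t w = 0.
  have : cross (cross (tw n) (tw m)) w = 0 by apply: orth_cross; rewrite -twE.
  rewrite tnm => /cross_eq0P [] /= h0 h1 h2.
  have n2 : (-2 : C) != 0 by rewrite oppr_eq0.
  congr (_, _, _); apply: (mulfI n2); rewrite mulr0 /=.
  - by apply: (@lincomb1 _ 1 _ _ _ _ h0); rewrite /t /=; ring.
  - by apply: (@lincomb1 _ 1 _ _ _ _ h1); rewrite /t /=; ring.
  - by apply: (@lincomb1 _ 1 _ _ _ _ h2); rewrite /t /=; ring.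
have [k wE] := cross_prop t0 ct.
have k0 : k != 0.
  by apply: contraNneq dw => kE; rewrite wE kE /delta /scale3 /=
    !mul0r expr0n subr0.
have Pt : P (t.1.2 * x - t.1.1 * y) (t.2 * x - t.1.2 * y) =
  (delta n * delta m) ^+ 3 * P x y.
  rewrite -(involution_invariant_mul hn hm) /t /=; congr P; first by ring.
  by apply: (@lincomb1 _ (- y) _ _ _ _ nm); rewrite /tau; ring.
have := hw x y.
rewrite {1 2 3 4}wE /scale3 /= -!mulrA -!mulrBr homP Pt.
have -> : delta w = - (k ^+ 2 * (delta n * delta m)).
  by rewrite wE -mulrN -dt /delta /scale3 /=; ring.
move=> h.
have /eqP : (2 * k ^+ 6 * (delta n * delta m) ^+ 3) * P x y = 0.
  by apply: (@lincomb1 _ 1 _ _ _ _ h); ring.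
have nz : 2 * k ^+ 6 * (delta n * delta m) ^+ 3 != 0.
  by rewrite !(mulf_neq0, expf_neq0).
by rewrite mulf_eq0 (negPf nz) => /eqP.
Qed.
(** * The sextics x^6 + t x^3 y^3 + y^6 *)

Definition Bt (t x y : C) : C := x ^+ 6 + t * (x ^+ 3 * y ^+ 3) + y ^+ 6.

Lemma Bt_normal_form (e0 e3 e6 : C) : e0 != 0 -> e6 != 0 ->
  exists r s t : C, [/\ r != 0, s != 0 & forall x y,
    e0 * (s * y) ^+ 6 + e3 * (r * x) ^+ 3 * (s * y) ^+ 3 + e6 * (r * x) ^+ 6
    = Bt t x y].
Proof.
move=> e00 e60; pose r := 6.-root e6; pose s := 6.-root e0.
have r6 : r ^+ 6 = e6 by rewrite rootCK.
have s6 : s ^+ 6 = e0 by rewrite rootCK.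
have r0 : r != 0 by rewrite rootC_eq0.
have s0 : s != 0 by rewrite rootC_eq0.
exists r^-1, s^-1, (e3 * r^-1 ^+ 3 * s^-1 ^+ 3); split; rewrite ?invr_eq0 //
  => x y.
by rewrite -r6 -s6 /Bt; field; rewrite r0 s0.
Qed.

(** * Sums of two cubes: common roots and double roots *)

Lemma delta0_root n : n != 0 -> delta n = 0 -> exists q1 q2 : C,
  (q1 != 0) || (q2 != 0) /\ forall f, dot f n = 0 -> qform f q1 q2 = 0.
Proof.
move=> n0 d0; case: (boolP ((n.1.2 != 0) || (n.2 != 0))) => [h|].
  (* On the conic [delta n = 0], n is a multiple of (q1^2, q1 q2, q2^2), and orthogonality to n
     means vanishing at (q1, q2). *)
  exists n.1.2, n.2; split=> // f hf; rewrite /qform.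
  by apply: (@lincomb2 _ n.2 _ _ f.1.1 _ _ _ _ hf d0); rewrite /dot /delta;
    ring.
rewrite negb_or !negbK => /andP[/eqP n1 /eqP n2].
have := triple_neq0P n0; rewrite n1 n2 eqxx !orbF => n00.
exists 1, 0; rewrite oner_neq0; split=> // f; rewrite /dot n1 n2 !mulr0 !addr0.
move/eqP; rewrite mulf_eq0 (negPf n00) orbF => /eqP f0.
by rewrite /qform f0; ring.
Qed.

(** If [delta] vanished, f and g would share a root, which would be a triple root of f^3 + g^3. *)
Lemma delta_cross_neq0 P f g : no_double_root P ->
  (forall x y, P x y = qform f x y ^+ 3 + qform g x y ^+ 3) ->
  cross f g != 0 -> delta (cross f g) != 0.
Proof.
move=> nP PE n0; apply/eqP => d0.
have [q1 [q2 [q0 hq]]] := delta0_root n0 d0.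
have [df dg] := dot_cross f g.
have [a [c D0]] : exists a c : C, a * q2 - q1 * c != 0.
  case/orP: q0 => h; [exists 0, 1 | exists 1, 0].
    by rewrite mul0r mulr1 sub0r oppr_eq0.
  by rewrite mul1r mulr0 subr0.
(* With the common root moved to (0, 1), each form h of the pencil is x times a linear form, in
   which [lin h] is the coefficient of y. *)
pose lin h := 2 * h.1.1 * a * q1 + h.1.2 * (a * q2 + q1 * c) + 2 * h.2 * c * q2.
have lE h x y : dot h (cross f g) = 0 -> qform h (a * x + q1 * y) (c * x +
  q2 * y) =
    x * (qform h a c * x + lin h * y).
  by move/hq => /(lincomb1 (k := y ^+ 2)); apply; rewrite /qform /lin; ring.
pose Qf := qform f a c; pose Qg := qform g a c.
pose e := nth 0 [:: 0; 0; 0; lin f ^+ 3 + lin g ^+ 3;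
  3 * (Qf * lin f ^+ 2 + Qg * lin g ^+ 2); 3 * (Qf ^+ 2 * lin f + Qg ^+
    2 * lin g);
  Qf ^+ 3 + Qg ^+ 3].
have := nP _ _ _ _ e D0; rewrite /e /= eqxx => /(_ _)/negP; apply=> // x y.
by rewrite PE !lE // bform6E /= -/Qf -/Qg; ring.
Qed.

Lemma cubes_coef f g c :
  (forall x y, bform 6 c x y = qform f x y ^+ 3 + qform g x y ^+ 3) ->
  [/\ c 0%N = f.2 ^+ 3 + g.2 ^+ 3,
      c 1%N = 3 * (f.1.2 * f.2 ^+ 2 + g.1.2 * g.2 ^+ 2),
      c 2 = 3 * (f.1.1 * f.2 ^+ 2 + f.1.2 ^+ 2 * f.2
               + g.1.1 * g.2 ^+ 2 + g.1.2 ^+ 2 * g.2) &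
      c 3 = f.1.2 ^+ 3 + 6 * f.1.1 * f.1.2 * f.2
          + g.1.2 ^+ 3 + 6 * g.1.1 * g.1.2 * g.2].
Proof.
move=> H.
pose co h := nth 0 [:: h.2 ^+ 3; 3 * (h.1.2 * h.2 ^+ 2);
   3 * (h.1.1 * h.2 ^+ 2 + h.1.2 ^+ 2 * h.2);
   h.1.2 ^+ 3 + 6 * h.1.1 * h.1.2 * h.2;
   3 * (h.1.1 ^+ 2 * h.2 + h.1.1 * h.1.2 ^+ 2); 3 * (h.1.1 ^+ 2 * h.1.2);
     h.1.1 ^+ 3] : nat -> C.
have /bform6_eq [[h0 h1 h2 h3] _] : forall x y, bform 6 c x y = bform 6 (fun i
  => co f i + co g i) x y.
  by move=> x y; rewrite H bform6E /co /qform /=; ring.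
by rewrite h0 h1 h2 h3 /co /=; split; ring.
Qed.

(* At a double root the gradient 3 (f^2 grad f + g^2 grad g) is 0, so the
   Jacobian of (f, g) vanishes there; its value at (0, 1) is, up to a factor 2,
   the first coordinate of the cross product. *)
Lemma cubes_double_root f g c :
  (forall x y, bform 6 c x y = qform f x y ^+ 3 + qform g x y ^+ 3) ->
  c 0%N = 0 -> c 1%N = 0 -> (cross f g).1.1 = 0.
Proof.
move=> /cubes_coef [-> -> _ _] h0 /eqP.
rewrite mulf_eq0 pnatr_eq0 /= => /eqP h1; rewrite /cross /=.
have [f2|fN] := eqVneq f.2 0.
  have /eqP : g.2 ^+ 3 = 0 by rewrite -h0 f2 expr0n add0r.
  by rewrite expf_eq0 /= => /eqP ->; rewrite f2 mulr0 mul0r subr0.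
apply: (mulfI (expf_neq0 2 fN)); rewrite mulr0.
by apply: (@lincomb2 _ g.2 _ _ (- g.1.2) _ _ _ _ h1 h0); ring.
Qed.

(* The left factor depends on the sextic only: at most one pencil works. *)
Lemma cubes_double_root_cross f g c : cross f g != 0 ->
  (forall x y, bform 6 c x y = qform f x y ^+ 3 + qform g x y ^+ 3) ->
  c 0%N = 0 -> c 1%N = 0 ->
  cross (if c 2 == 0 then (0, 0, 1) else (0, - 2 * c 2, c 3)) (cross f g) = 0.
Proof.
move=> n0 H c0 c1; have n00 := cubes_double_root H c0 c1.
have [/esym h0 _ cE2 cE3] := cubes_coef H; move: n0 n00 (dot_cross f g).
rewrite c0 in h0.
set n := cross f g => n0 n00 [df _].
have nE0 : f.1.2 * g.2 = f.2 * g.1.2 by apply/subr0_eq.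
have nE1 : n.1.2 = f.2 * g.1.1 - f.1.1 * g.2 by [].
clearbody n.
(* Either f and g both vanish at (0, 1), and then c_2 = 0 and n is parallel to (0, 0, 1), or c_2 is
   shown to be nonzero. *)
have [f2|fN] := eqVneq f.2 0.
  have /eqP : g.2 ^+ 3 = 0 by rewrite -h0 f2 expr0n add0r.
  rewrite expf_eq0 /= => /eqP g2.
  have -> : c 2 = 0 by rewrite cE2 f2 g2; ring.
  have n1 : n.1.2 = 0 by rewrite nE1 f2 g2; ring.
  by rewrite eqxx /cross /= n1 n00; congr (_, _, _); ring.
have c2E : f.2 * c 2 = 3 * g.2 ^+ 2 * n.1.2.
  apply: (mulfI fN); rewrite cE2 nE1.
  by apply: (@lincomb2 _ (3 * f.1.1 * f.2 + 3 * f.1.2 ^+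
    2) _ _ (3 * g.2 * (f.1.2 * g.2 + f.2 * g.1.2) * (-1)) _ _ _ _ h0 nE0); ring.
have g20 : g.2 != 0.
  apply: contraNneq fN => g2; move: h0; rewrite g2 expr0n addr0 => /eqP.
  by rewrite expf_eq0.
have n10 : n.1.2 != 0.
  apply/eqP => n1; have := triple_neq0P n0; rewrite n00 n1 eqxx /= => n2.
  move: df; rewrite /dot n00 n1 !mulr0 !add0r => /eqP.
  by rewrite mulf_eq0 (negPf fN) (negPf n2).
have c20 : c 2 != 0.
  apply/eqP => c2; move/eqP: c2E; rewrite c2 mulr0 eq_sym; apply/negP.
  by rewrite !(mulf_neq0, expf_neq0) // pnatr_eq0.
rewrite (negPf c20).
have g1E : g.1.2 = f.1.2 * g.2 / f.2 by rewrite nE0; field.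
(* Orthogonality to f gives n1 : n2 = - f2 : f1; this equation reads that ratio off from the
   sextic. *)
have c3E : c 3 * f.2 = 2 * c 2 * f.1.2.
  apply: (mulfI (expf_neq0 2 fN)); rewrite cE3 cE2 g1E.
  apply: (@lincomb1 _ (- 5 * f.1.2 ^+ 3) _ _ _ _ h0); field.
  exact: fN.
have E : 2 * c 2 * n.2 + c 3 * n.1.2 = 0.
  apply: (mulfI fN); rewrite mulr0; move: df; rewrite /dot n00 mulr0 add0r
    => df.
  by apply: (@lincomb2 _ (2 * c 2) _ _ n.1.2 _ _ _ _ df c3E); ring.
congr (_, _, _); rewrite /= ?n00; [|ring|ring].
by apply: (@lincomb1 _ (-1) _ _ _ _ E); ring.
Qed.

(** * Double roots and involutions of x^6 + t x^3 y^3 + y^6 *)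

Definition Bt_coefs (t a b c d : C) : nat -> C := nth 0 [::
  b ^+ 6 + t * (b ^+ 3 * d ^+ 3) + d ^+ 6;
  6 * a * b ^+ 5 + t * (3 * a * b ^+ 2 * d ^+ 3 + 3 * b ^+ 3 * c * d ^+ 2) +
    6 * c * d ^+ 5;
  15 * a ^+ 2 * b ^+ 4 + t * (3 * a ^+ 2 * b * d ^+ 3 + 9 * a * b ^+
    2 * c * d ^+ 2
    + 3 * b ^+ 3 * c ^+ 2 * d) + 15 * c ^+ 2 * d ^+ 4;
  20 * a ^+ 3 * b ^+ 3 + t * (a ^+ 3 * d ^+ 3 + 9 * a ^+ 2 * b * c * d ^+ 2
    + 9 * a * b ^+ 2 * c ^+ 2 * d + b ^+ 3 * c ^+ 3) + 20 * c ^+ 3 * d ^+ 3;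
  15 * a ^+ 4 * b ^+ 2 + t * (3 * a ^+ 3 * c * d ^+ 2 + 9 * a ^+ 2 * b * c ^+
    2 * d
    + 3 * a * b ^+ 2 * c ^+ 3) + 15 * c ^+ 4 * d ^+ 2;
  6 * a ^+ 5 * b + t * (3 * a ^+ 3 * c ^+ 2 * d + 3 * a ^+ 2 * b * c ^+ 3) +
    6 * c ^+ 5 * d;
  a ^+ 6 + t * (a ^+ 3 * c ^+ 3) + c ^+ 6].

Lemma Bt_subst (t a b c d x y : C) :
  Bt t (a * x + b * y) (c * x + d * y) = bform 6 (Bt_coefs t a b c d) x y.
Proof. by rewrite bform6E /Bt /Bt_coefs /=; ring. Qed.

Lemma sextic_Bt (t : C) : sextic (Bt t).
Proof. by move=> a b c d; exists (Bt_coefs t a b c d) => x y;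
  rewrite Bt_subst. Qed.

(** The coefficient e_1 is the derivative at (b, d) along (a, c), and 6 e_0 the one along (b, d) by
    Euler's relation. If both are 0, so are the partial derivatives 3 b^2 (2 b^3 + t d^3) and 3 d^2
    (2 d^3 + t b^3), which forces t^2 = 4. *)
Lemma no_double_root_Bt (t : C) : t ^+ 2 != 4 -> no_double_root (Bt t).
Proof.
move=> t2 a b c d e D0 H; apply: contraT; rewrite negb_or !negbK
  => /andP[/eqP e0 /eqP e1].
have /bform6_eq [[h0 h1 _ _] _] : forall x y, bform 6 (Bt_coefs t a b c d) x y
  = bform 6 e x y.
  by move=> x y; rewrite -Bt_subst.
move: h0 h1; rewrite e0 e1 /Bt_coefs /= => h0 h1.
have six : (6 : C) != 0 by rewrite pnatr_eq0.
have three : (3 : C) != 0 by rewrite pnatr_eq0.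
have bx : b ^+ 2 * (2 * b ^+ 3 + t * d ^+ 3) = 0.
  apply: (mulfI three); apply: (mulfI D0); rewrite !mulr0.
  by apply: (@lincomb2 _ d _ _ (- 6 * c) _ _ _ _ h1 h0); ring.
have dx : d ^+ 2 * (2 * d ^+ 3 + t * b ^+ 3) = 0.
  apply: (mulfI three); apply: (mulfI D0); rewrite !mulr0.
  by apply: (@lincomb2 _ (- b) _ _ (6 * a) _ _ _ _ h1 h0); ring.
have two : (2 : C) != 0 by rewrite pnatr_eq0.
have [bE|bN] := eqVneq b 0.
  move/eqP: dx; rewrite bE expr0n /= mulr0 addr0 mulrCA -exprD mulf_eq0 (negPf
    two).
  by rewrite expf_eq0 /= => /eqP dE; rewrite bE dE !(mulr0,
    mul0r) subrr eqxx in D0.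
have [dE|dN] := eqVneq d 0.
  move/eqP: bx; rewrite dE expr0n /= mulr0 addr0 mulrCA -exprD mulf_eq0 (negPf
    two).
  by rewrite expf_eq0 (negPf bN).
case/eqP: t2; apply: (mulfI (expf_neq0 3 bN)).
have hb : 2 * b ^+ 3 + t * d ^+ 3 = 0 by apply: (mulfI (expf_neq0 2 bN));
  rewrite bx mulr0.
have hd : 2 * d ^+ 3 + t * b ^+ 3 = 0 by apply: (mulfI (expf_neq0 2 dN));
  rewrite dx mulr0.
by apply: (@lincomb2 _ t _ _ (- 2) _ _ _ _ hd hb); ring.
Qed.

(** Here M_n is (x, y) -> (z y, z^2 x), which exchanges x^3 and y^3, and [delta] is z^3 = 1. *)
Lemma invol_Bt (t z : C) : z ^+ 3 = 1 -> involution_invariant (Bt t) (- z, 0,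
  z ^+ 2).
Proof.
move=> z3 x y; rewrite /Bt /delta /=.
have z6 : z ^+ 6 = 1 by rewrite (_ : 6%N = 3 * 2)%N // exprM z3 expr1n.
have z12 : z ^+ 12 = 1 by rewrite (_ : 12%N = 3 * 4)%N // exprM z3 expr1n.
have z9 : z ^+ 9 = 1 by rewrite (_ : 9%N = 3 * 3)%N // exprM z3 expr1n.
transitivity (z ^+ 6 * y ^+ 6 + t * z ^+ 9 * (x ^+ 3 * y ^+ 3) + z ^+ 12 * x ^+
  6).
  by ring.
rewrite z6 z9 z12; transitivity ((z ^+ 3) ^+ 3 * (x ^+ 6 + t * (x ^+ 3 * y ^+
  3) + y ^+ 6)).
  by rewrite z3; ring.
by ring.
Qed.

(** The hypotheses determine n up to scale and the sign of e. Invariance at (1, 0) becomes e^6 - t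
    e^3 + 1 = - 27, that is t e = - 10. *)
Lemma Bt_octahedral (t z : C) n : z ^+ 3 = 1 -> involution_invariant (Bt t) n
  -> delta n != 0 ->
  n.2 = z * n.1.1 -> n.1.2 ^+ 2 = - 2 * z * n.1.1 ^+ 2 ->
  exists e, [/\ e ^+ 2 = - 2, t = 5 * e & cross (- z, e, - z ^+ 2) n = 0].
Proof.
move=> z3 inv d0 n2 n1.
have z0 := cube_root_of_unity_neq0 z3.
have n0 : n.1.1 != 0.
  apply: contraNneq d0 => n0; rewrite /delta n1 n2 n0; apply/eqP; ring.
pose e := - n.1.2 * z / n.1.1.
have aE : n.1.2 = - e * n.1.1 * z ^+ 2.
  rewrite /e; transitivity (n.1.2 * z ^+ 3); first by rewrite z3 mulr1.
  by field.
have e2 : e ^+ 2 = - 2.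
  transitivity (n.1.2 ^+ 2 * z ^+ 2 / n.1.1 ^+ 2); first by rewrite /e; field.
  rewrite n1; transitivity (-2 * z ^+ 3); first by field.
  by rewrite z3 mulr1.
exists e; split=> //; last first.
  rewrite /cross /= n2 aE; congr (_, _, _); [|ring|].
    by apply: (@lincomb1 _ (- e * z * n.1.1) _ _ _ _ z3); ring.
  by apply: (@lincomb1 _ (e * n.1.1) _ _ _ _ z3); ring.
have := inv 1 0; rewrite /Bt /delta !mulr0 !mulr1 !subr0 !expr1n !expr0n /=
  n1 n2 mulr0 !addr0.
rewrite aE => h.
have n6 : n.1.1 ^+ 6 != 0 by rewrite expf_neq0.
have z6 : z ^+ 6 = 1 by rewrite (_ : 6%N = 3 * 2)%N // exprM z3 expr1n.
have e3 : e ^+ 3 = - 2 * e by rewrite exprS e2 mulrC.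
have e6 : e ^+ 6 = - 8 by rewrite (_ : 6%N = 2 * 3)%N // exprM e2; ring.
have two : (2 : C) != 0 by rewrite pnatr_eq0.
have h1 : e ^+ 6 - t * e ^+ 3 + 1 = - 27.
  apply: (mulfI n6); transitivity (e ^+ 6 * n.1.1 ^+ 6 * (z ^+ 6) ^+ 2
    - t * e ^+ 3 * n.1.1 ^+ 6 * z ^+ 6 * z ^+ 3 + z ^+ 6 * n.1.1 ^+ 6).
    by rewrite z6 z3; ring.
  transitivity (- 27 * z ^+ 3 * n.1.1 ^+ 6); last by rewrite z3; ring.
  by apply: (@lincomb1 _ 1 _ _ _ _ h); ring.
rewrite e3 e6 in h1.
apply: (mulfI (mulf_neq0 two two)).
apply: (@lincomb2 _ (- e) _ _ (2 * t) _ _ _ _ h1 e2).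
by ring.
Qed.

(** The traces against the three dihedral involutions sum to 0 and cannot all be square roots of
    [delta n], so one of them is 0, say at z. The trace at z o then decides: if it is 0, n is
    diagonal and t = 0; otherwise [Bt_octahedral] applies. *)
Lemma Bt_invol_classification (t o : C) n : o ^+ 2 + o + 1 = 0 ->
  t ^+ 2 != 4 -> involution_invariant (Bt t) n -> delta n != 0 ->
  [\/ exists2 z, z ^+ 3 = 1 & cross (- z, 0, z ^+ 2) n = 0,
      t = 0 /\ cross (0, 1, 0) n = 0
    | exists z e, [/\ z ^+ 3 = 1, e ^+ 2 = - 2, t = 5 * e
                    & cross (- z, e, - z ^+ 2) n = 0]].
Proof.
move=> oE t2 inv d0.
have two : (2 : C) != 0 by rewrite pnatr_eq0.
have three : (3 : C) != 0 by rewrite pnatr_eq0.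
have o3 : o ^+ 3 = 1 by apply: (@lincomb1 _ (o - 1) _ _ _ _ oE); ring.
have dich z : z ^+ 3 = 1 -> cross (- z, 0, z ^+ 2) n != 0 ->
    tau (- z, 0, z ^+ 2) n = 0 \/ tau (- z, 0, z ^+ 2) n ^+ 2 = delta n.
  move=> z3 cN; have dz : delta (- z, 0, z ^+ 2) = 1.
    by rewrite /delta /= -[RHS]z3; ring.
  have := two_involutions (sextic_Bt t) (no_double_root_Bt t2) _ d0 (invol_Bt t
    z3) inv cN.
  by rewrite dz mul1r oner_eq0 => /(_ isT) [|[]]; [left|right].
have tauE z : tau (- z, 0, z ^+ 2) n = z * n.2 - z ^+ 2 * n.1.1.
  by rewrite /tau /=; ring.
have diag : n.1.1 = 0 -> n.2 = 0 -> t = 0 /\ cross (0, 1, 0) n = 0.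
  move=> n0 n2; split; last by rewrite /cross /= n0 n2; congr (_, _, _); ring.
  have dE : delta n = n.1.2 ^+ 2 by rewrite /delta n0 n2; ring.
  have n1 : n.1.2 != 0 by move: d0; rewrite dE expf_eq0.
  (* For diagonal n, invariance at (1, 1) reads 2 - t = 2 + t, up to the factor n1^6. *)
  apply: (mulfI (mulf_neq0 two (expf_neq0 6 n1))).
  have := inv 1 1; rewrite dE n0 n2 /Bt => h.
  by apply: (@lincomb1 _ (-1) _ _ _ _ h); ring.
have key z : z ^+ 3 = 1 -> tau (- z, 0, z ^+ 2) n = 0 ->
    cross (- (z * o), 0, (z * o) ^+ 2) n != 0 ->
    [\/ exists2 z, z ^+ 3 = 1 & cross (- z, 0, z ^+ 2) n = 0,
        t = 0 /\ cross (0, 1, 0) n = 0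
      | exists z e, [/\ z ^+ 3 = 1, e ^+ 2 = - 2, t = 5 * e
                      & cross (- z, e, - z ^+ 2) n = 0]].
  move=> z3; rewrite tauE => tz cN.
  have z0 := cube_root_of_unity_neq0 z3.
  have n2 : n.2 = z * n.1.1.
    by apply: (mulfI z0); apply: (@lincomb1 _ 1 _ _ _ _ tz); ring.
  have zo3 : (z * o) ^+ 3 = 1 by rewrite exprMn z3 o3 mulr1.
  have tzo : tau (- (z * o), 0, (z * o) ^+ 2) n = z ^+ 2 * (2 * o + 1) * n.1.1.
    rewrite tauE n2.
    by apply: (@lincomb1 _ (- z ^+ 2 * n.1.1) _ _ _ _ oE); ring.
  have o21 : (2 * o + 1) ^+ 2 = - 3.
    by apply: (@lincomb1 _ 4 _ _ _ _ oE); ring.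
  have o20 : 2 * o + 1 != 0.
    by apply: contra_eq_neq o21 => ->; rewrite expr0n eq_sym oppr_eq0.
  case: (dich _ zo3 cN); rewrite tzo => h.
    apply: Or32; have n0 : n.1.1 = 0.
      by apply: (mulfI (mulf_neq0 (expf_neq0 2 z0) o20)); rewrite h mulr0.
    by apply: diag => //; rewrite n2 n0 mulr0.
  have n1 : n.1.2 ^+ 2 = - 2 * z * n.1.1 ^+ 2.
    have h' : - 3 * z * n.1.1 ^+ 2 = delta n.
      transitivity (- 3 * z * z ^+ 3 * n.1.1 ^+ 2); first by rewrite z3 mulr1.
      by rewrite -h -o21; ring.
    by apply: (@lincomb1 _ (-1) _ _ _ _ h'); rewrite /delta n2; ring.
  have [e [e2 tE cE]] := Bt_octahedral z3 inv d0 n2 n1.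
  by apply: Or33; exists z, e.
have [c1|c1] := eqVneq (cross (- 1, 0, 1 ^+ 2) n) 0.
  by apply: Or31; exists 1 => //; exact: expr1n.
have [co|co] := eqVneq (cross (- o, 0, o ^+ 2) n) 0.
  by apply: Or31; exists o.
have oo3 : (o * o) ^+ 3 = 1 by rewrite exprMn o3 mulr1.
have [coo|coo] := eqVneq (cross (- (o * o), 0, (o * o) ^+ 2) n) 0.
  by apply: Or31; exists (o * o).
have one3 : (1 : C) ^+ 3 = 1 by rewrite expr1n.
case: (dich _ one3 c1) => [h|h1].
  by apply: (key 1) => //; rewrite mul1r.
case: (dich _ o3 co) => [h|ho]; first exact: (key o).
case: (dich _ oo3 coo) => [h|hoo].
  by apply: (key (o * o)) => //; rewrite -mulrA -expr2 -exprS o3.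
(* Three numbers with equal squares and sum 0 are all 0. *)
case/eqP: d0; move: h1 ho hoo; rewrite !tauE; set a := _ - _; set b := _ - _.
set c := _ - _ => ha hb hc.
have abc : a + b + c = 0.
  rewrite /a /b /c.
  by apply: (@lincomb1 _ (n.2 - n.1.1 * (o ^+ 2 - o + 1)) _ _ _ _ oE); ring.
have : (a - b) * (a + b) = 0 by apply: (@lincomb2 _ 1 _ _ (-1) _ _ _ _ ha hb);
  ring.
have cE : c = - (a + b) by apply: (@lincomb1 _ 1 _ _ _ _ abc); ring.
move/eqP; rewrite mulf_eq0 => /orP[/eqP ab|/eqP ab].
  have aE : a = b by apply: (@lincomb1 _ 1 _ _ _ _ ab); ring.
  apply: (mulfI three); rewrite mulr0.
  move: hc; rewrite cE -aE => hc.
  by apply: (@lincomb2 _ (- 4) _ _ 1 _ _ _ _ ha hc); ring.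
by rewrite -hc cE ab oppr0 expr0n.
Qed.

(** The forms m = x^2 + z^2 y^2 and k = z x y span the pencil orthogonal to (- z, 0, z^2), and B_t
    is a binary cubic in them. It is a combination of the cubes of the linear factors of its Hessian
    m^2 - t m k + k^2, which are distinct as t^2 <> 4. *)
Lemma Bt_rep_generic (t z : C) : t ^+ 2 != 4 -> z ^+ 3 = 1 -> exists f g,
  [/\ forall x y, Bt t x y = qform f x y ^+ 3 + qform g x y ^+ 3,
      cross f g != 0 & cross (- z, 0, z ^+ 2) (cross f g) = 0].
Proof.
move=> t2 z3.
have two : (2 : C) != 0 by rewrite pnatr_eq0.
have z0 := cube_root_of_unity_neq0 z3.
pose D := sqrtC (t ^+ 2 - 4); have D2 : D ^+ 2 = t ^+ 2 - 4 by rewrite sqrtCK.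
have D0 : D != 0 by rewrite sqrtC_eq0 subr_eq0.
pose al := (D - t) / 2; pose be := (- D - t) / 2.
have ab : al * be = 1.
  by apply: (@lincomb1 _ (- 1 / 4) _ _ _ _ D2); rewrite /al /be; field.
have abD : al - be = D by rewrite /al /be; field.
have abt : t = - (al + be) by rewrite /al /be; field.
(* The weights satisfy u^3 + v^3 = 1 and u^3 al + v^3 be = 0, matching the coefficients of m^3 and
   m^2 k. *)
pose u := 3.-root (- be / D); pose v := 3.-root (al / D).
have u3 : u ^+ 3 = - be / D by rewrite rootCK.
have v3 : v ^+ 3 = al / D by rewrite rootCK.
have al0 : al != 0 by apply: contra_eq_neq ab => ->;
  rewrite mul0r eq_sym oner_eq0.
have be0 : be != 0 by apply: contra_eq_neq ab => ->;
  rewrite mulr0 eq_sym oner_eq0.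
have u0 : u != 0 by rewrite rootC_eq0 // mulf_neq0 ?oppr_eq0 ?invr_eq0.
have v0 : v != 0 by rewrite rootC_eq0 // mulf_neq0 ?invr_eq0.
have z6 : z ^+ 6 = 1 by rewrite (_ : 6%N = 3 * 2)%N // exprM z3 expr1n.
exists (u, u * al * z, u * z ^+ 2), (v, v * be * z, v * z ^+ 2); split.
- move=> x y.
  (* B_t = m^3 - 3 m k^2 + t k^3, where al and be are the roots of
     X^2 + t X + 1. *)
  pose m := x ^+ 2 + z ^+ 2 * y ^+ 2; pose k := z * x * y.
  transitivity (u ^+ 3 * (m + al * k) ^+ 3 + v ^+ 3 * (m + be * k) ^+ 3);
    last first.
    by rewrite /qform /m /k /=; ring.
  rewrite u3 v3; transitivity (m ^+ 3 - 3 * (al * be) * m * k ^+ 2 -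
    (al * be) * (al + be) * k ^+ 3).
    rewrite ab abt /m /k /Bt.
    have -> : y ^+ 6 = z ^+ 6 * y ^+ 6 by rewrite z6 mul1r.
    apply: (@lincomb1 _ ((al + be) * x ^+ 3 * y ^+ 3) _ _ _ _ z3); ring.
  have E : - be / D * (m + al * k) ^+ 3 + al / D * (m + be * k) ^+ 3 =
     (al - be) / D * (m ^+ 3 - 3 * (al * be) * m * k ^+ 2 - (al * be) * (al +
       be) * k ^+ 3).
    by field.
  by rewrite E abD divff // mul1r.
- apply/eqP=> /cross_eq0P[_ _] /= /eqP.
  rewrite -subr_eq0 (_ : _ - _ = - (u * v * z * (al - be))); last ring.
  by rewrite abD oppr_eq0; apply/negP; rewrite !mulf_neq0.
- rewrite /cross /=; congr (_, _, _); [ring| |ring].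
  by apply: (@lincomb1 _ (u * v * (al - be) * z ^+ 2) _ _ _ _ z3); ring.
Qed.

Lemma Bt_rep_diagonal : exists f g,
  [/\ forall x y, Bt 0 x y = qform f x y ^+ 3 + qform g x y ^+ 3,
      cross f g != 0 & cross (0, 1, 0) (cross f g) = 0].
Proof.
exists (1, 0, 0), (0, 0, 1); split.
- by move=> x y; rewrite /Bt /qform /=; ring.
- apply/eqP=> /cross_eq0P[_ /= /eqP].
  by rewrite !mulr0 mul1r eq_sym oner_eq0.
- by rewrite /cross /=; congr (_, _, _); ring.
Qed.

(** The pencil orthogonal to (- z, e, - z^2) is spanned by m = x^2 - z^2 y^2 and k = e (x^2 + z^2
    y^2) + 2 z x y; the two forms are u (k + r m) and u (k - r m) with r^2 = 2. *)
Lemma Bt_rep_octahedral (e z : C) : e ^+ 2 = - 2 -> z ^+ 3 = 1 -> exists f g,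
  [/\ forall x y, Bt (5 * e) x y = qform f x y ^+ 3 + qform g x y ^+ 3,
      cross f g != 0 & cross (- z, e, - z ^+ 2) (cross f g) = 0].
Proof.
move=> e2 z3.
have two : (2 : C) != 0 by rewrite pnatr_eq0.
have z0 := cube_root_of_unity_neq0 z3.
have e0 : e != 0.
  apply: contra_eq_neq e2 => ->; rewrite expr0n /= eq_sym oppr_eq0 //.
pose u := 3.-root (- e / 16); have u3 : u ^+ 3 = - e / 16 by rewrite rootCK.
have n16 : (16 : C) != 0 by rewrite pnatr_eq0.
have u0 : u != 0 by rewrite rootC_eq0 // mulf_neq0 ?oppr_eq0 ?invr_eq0.
pose r := sqrtC (2 : C); have r2 : r ^+ 2 = 2 by rewrite sqrtCK.
have r0 : r != 0 by rewrite sqrtC_eq0.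
have z6 : z ^+ 6 = 1 by rewrite (_ : 6%N = 3 * 2)%N // exprM z3 expr1n.
exists (u * (e + r), 2 * u * z, u * (e - r) * z ^+ 2),
       (u * (e - r), 2 * u * z, u * (e + r) * z ^+ 2); split.
- move=> x y.
  (* B_(5 e) = - e / 8 (k^3 + 6 m^2 k). *)
  pose m := x ^+ 2 - z ^+ 2 * y ^+ 2; pose k := e * (x ^+ 2 + z ^+ 2 * y ^+
    2) + 2 * z * x * y.
  transitivity (2 * u ^+ 3 * (k ^+ 3 + 3 * r ^+ 2 * m ^+ 2 * k)); last first.
    by rewrite /qform /m /k /=; ring.
  rewrite u3 r2.
  have e3 : e ^+ 3 = - 2 * e by rewrite exprS e2 mulrC.
  have e4 : e ^+ 4 = 4 by rewrite (_ : 4%N = 2 * 2)%N // exprM e2; ring.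
  pose X := x; pose Y := z * y.
  transitivity (X ^+ 6 + 5 * e * (X ^+ 3 * Y ^+ 3) + Y ^+ 6).
    rewrite /X /Y /Bt !exprMn z3 z6; ring.
  have -> : k = e * (X ^+ 2 + Y ^+ 2) + 2 * X * Y by rewrite /k /X /Y; ring.
  have -> : m = X ^+ 2 - Y ^+ 2 by rewrite /m /X /Y; ring.
  transitivity (- (e ^+ 4 * (X ^+ 2 + Y ^+ 2) ^+ 3 + 6 * e ^+ 3 * (X ^+ 2 +
    Y ^+ 2) ^+ 2 * X * Y
     + 12 * e ^+ 2 * (X ^+ 2 + Y ^+ 2) * X ^+ 2 * Y ^+ 2 + 8 * e * X ^+
       3 * Y ^+ 3
     + 6 * (X ^+ 2 - Y ^+ 2) ^+ 2 * (e ^+ 2 * (X ^+ 2 + Y ^+ 2) +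
       2 * e * X * Y)) / 8); last by field.
  by rewrite e4 e3 e2; field.
- apply/eqP=> /cross_eq0P[/= /eqP E _ _]; move: E.
  rewrite -subr_eq0 (_ : _ - _ = 4 * u ^+ 2 * r * z ^+ 3); last ring.
  by apply/negP; rewrite !mulf_neq0 ?expf_neq0 // pnatr_eq0.
- rewrite /cross /=; congr (_, _, _); [| |ring].
    by apply: (@lincomb1 _ (- 4 * r * e * z * u ^+ 2) _ _ _ _ z3); ring.
  by apply: (@lincomb1 _ (- 4 * r * z ^+ 2 * u ^+ 2) _ _ _ _ z3); ring.
Qed.

(** Cramer's rule with a nonzero minor of f and g; the remaining coordinate follows from the
    vanishing of det (f, g, h). *)
Lemma cross_span f g h : cross f g != 0 -> dot h (cross f g) = 0 ->
  exists a b : C, h = (a * f.1.1 + b * g.1.1, a * f.1.2 + b * g.1.2,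
    a * f.2 + b * g.2).
Proof.
move=> /triple_neq0P; rewrite /dot.
case: f g h => [[f0 f1] f2] [[g0 g1] g2] [[h0 h1] h2] /=.
case/or3P => nz hn.
- exists ((h1 * g2 - h2 * g1) / (f1 * g2 - f2 * g1)),
  ((f1 * h2 - f2 * h1) / (f1 * g2 - f2 * g1)).
  congr (_, _, _); apply: (mulfI nz).
  + by apply: (@lincomb1 _ 1 _ _ _ _ hn); field.
  + by field.
  + by field.
- exists ((h2 * g0 - h0 * g2) / (f2 * g0 - f0 * g2)),
  ((f2 * h0 - f0 * h2) / (f2 * g0 - f0 * g2)).
  congr (_, _, _); apply: (mulfI nz).
  + by field.
  + by apply: (@lincomb1 _ 1 _ _ _ _ hn); field.
  + by field.
- exists ((h0 * g1 - h1 * g0) / (f0 * g1 - f1 * g0)),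
  ((f0 * h1 - f1 * h0) / (f0 * g1 - f1 * g0)).
  congr (_, _, _); apply: (mulfI nz).
  + by field.
  + by field.
  + by apply: (@lincomb1 _ 1 _ _ _ _ hn); field.
Qed.

(** * The listed involutions are pairwise distinct *)

Lemma cross_dihedral (z w : C) : z ^+ 3 = 1 -> w ^+ 3 = 1 -> z != w ->
  cross (- z, 0, z ^+ 2) (- w, 0, w ^+ 2) != 0.
Proof.
move=> /cube_root_of_unity_neq0 z0 /cube_root_of_unity_neq0 w0;
  apply: contra_neq => /cross_eq0P[_ /= h _].
apply: (mulfI (mulf_neq0 z0 w0)).
by apply: (@lincomb1 _ (-1) _ _ _ _ h); ring.
Qed.

Lemma cross_dihedral_diagonal (z : C) : z ^+ 3 = 1 ->
  cross (- z, 0, z ^+ 2) (0, 1, 0) != 0.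
Proof.
move=> z3; apply/eqP => /cross_eq0P[_ _ /= /eqP].
rewrite mulr1 mul0r oppr_eq0 => /eqP z0; move/eqP: z3.
by rewrite z0 expr0n eq_sym oner_eq0.
Qed.

Lemma cross_dihedral_octahedral (z w e : C) : z ^+ 3 = 1 -> w ^+ 3 = 1 ->
  cross (- z, 0, z ^+ 2) (- w, e, - w ^+ 2) != 0.
Proof.
move=> z3 w3; have z0 := cube_root_of_unity_neq0 z3;
  have w0 := cube_root_of_unity_neq0 w3.
apply/eqP=> /cross_eq0P[_ /= h _].
have zw : z = - w.
  apply: (mulfI (mulf_neq0 z0 w0)).
  by apply: (@lincomb1 _ (-1) _ _ _ _ h); ring.
have : (2 : C) = 0 by apply: (@lincomb2 _ (-1) _ _ (-1) _ _ _ _ z3 w3);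
  rewrite zw; ring.
by move/eqP; rewrite pnatr_eq0.
Qed.

Lemma cross_octahedral (z w e : C) : e != 0 -> z != w ->
  cross (- z, e, - z ^+ 2) (- w, e, - w ^+ 2) != 0.
Proof.
move=> e0; apply: contra_neq => /cross_eq0P[_ _ /= h].
by apply: (mulfI e0); apply: (@lincomb1 _ (-1) _ _ _ _ h); ring.
Qed.

End Core.

(** * Sums of two cubes in a pencil *)

Section PencilOverDomain.
Variables (C : numClosedFieldType) (A : idomainType) (io : {rmorphism C -> A}).
Variables F G : A.
Hypothesis FG_free : forall a b : C, io a * F + io b * G = 0 -> a = 0 /\ b = 0.

(** Over an algebraically closed field a binary form in F and G has a linear factor F - l G, and in
    a domain one of the factors must vanish. The cubic case reduces to this one in the same way. *)
Lemma quadratic_free (c0 c1 c2 : C) :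
  io c0 * F ^+ 2 + io c1 * F * G + io c2 * G ^+ 2 = 0 -> [/\ c0 = 0,
    c1 = 0 & c2 = 0].
Proof.
have G0 : G != 0.
  apply/eqP => G0; case: (@FG_free 0 1) => [|_ /eqP]; last by rewrite oner_eq0.
  by rewrite G0 rmorph0 mulr0 mul0r addr0.
have [-> h|c0N h] := eqVneq c0 0.
  have [] := @FG_free c1 c2; last by split.
  apply: (mulfI G0); rewrite mulr0 -[RHS]h rmorph0; ring.
have [l lE] := @solve_monicpoly C 2 (nth 0 [:: - (c2 / c0); - (c1 / c0)]) isT.
rewrite !big_ord_recl big_ord0 /= in lE.
have c2E : c2 = - (c0 * l ^+ 2 + c1 * l) by rewrite lE; field.
have /eqP : (io 1 * F + io (- l) * G) * (io c0 * F + io (c0 * l + c1) * G) = 0.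
  by rewrite -[RHS]h c2E; ring.
rewrite mulf_eq0 => /orP[] /eqP /FG_free [].
  by move=> /eqP; rewrite oner_eq0.
by move=> c00; rewrite c00 eqxx in c0N.
Qed.

Lemma cubic_free (c0 c1 c2 c3 : C) :
  io c0 * F ^+ 3 + io c1 * F ^+ 2 * G + io c2 * F * G ^+ 2 + io c3 * G ^+ 3 = 0
    ->
  [/\ c0 = 0, c1 = 0, c2 = 0 & c3 = 0].
Proof.
have G0 : G != 0.
  apply/eqP => G0; case: (@FG_free 0 1) => [|_ /eqP]; last by rewrite oner_eq0.
  by rewrite G0 rmorph0 mulr0 mul0r addr0.
have [-> h|c0N h] := eqVneq c0 0.
  have [] := @quadratic_free c1 c2 c3; last by split.
  by apply: (mulfI G0); rewrite mulr0 -[RHS]h rmorph0; ring.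
have [l lE] := @solve_monicpoly C 3 (nth 0 [:: - (c3 / c0); - (c2 / c0);
  - (c1 / c0)]) isT.
rewrite !big_ord_recl big_ord0 /= in lE.
have c3E : c3 = - (c0 * l ^+ 3 + c1 * l ^+ 2 + c2 * l) by rewrite lE; field.
have /eqP : (io 1 * F + io (- l) * G) * (io c0 * F ^+ 2 + io (c0 * l +
  c1) * F * G
    + io (c0 * l ^+ 2 + c1 * l + c2) * G ^+ 2) = 0.
  by rewrite -[RHS]h c3E; ring.
rewrite mulf_eq0 => /orP[/eqP /FG_free []|/eqP /quadratic_free []].
  by move=> /eqP; rewrite oner_eq0.
by move=> c00; rewrite c00 eqxx in c0N.
Qed.

(* Comparing coefficients of F^2 G and F G^2 forces the transition matrix to be
   monomial. *)
Lemma cubes_in_pencil (a b c d : C) (F' G' : A) : a * d - b * c != 0 ->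
  F' = io a * F + io b * G -> G' = io c * F + io d * G ->
  F ^+ 3 + G ^+ 3 = F' ^+ 3 + G' ^+ 3 ->
  F' ^+ 3 = F ^+ 3 /\ G' ^+ 3 = G ^+ 3 \/ F' ^+ 3 = G ^+ 3 /\ G' ^+ 3 = F ^+ 3.
Proof.
move=> D0 -> -> h.
have three : (3 : C) != 0 by rewrite pnatr_eq0.
have [h0 h1 h2 h3] : [/\ a ^+ 3 + c ^+ 3 - 1 = 0,
  3 * (a ^+ 2 * b + c ^+ 2 * d) = 0,
    3 * (a * b ^+ 2 + c * d ^+ 2) = 0 & b ^+ 3 + d ^+ 3 - 1 = 0].
  apply: cubic_free; apply: (@lincomb1 _ (-1) _ _ _ _ h); ring.
have h1' : a ^+ 2 * b + c ^+ 2 * d = 0 by apply: (mulfI three);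
  rewrite h1 mulr0.
have h2' : a * b ^+ 2 + c * d ^+ 2 = 0 by apply: (mulfI three);
  rewrite h2 mulr0.
(* Hence a = 0 or b = 0, and F' is a multiple of G or of F. *)
have /eqP : a * b * (a * d - b * c) = 0.
  by apply: (@lincomb2 _ d _ _ (- c) _ _ _ _ h1' h2'); ring.
rewrite !mulf_eq0 (negPf D0) orbF => /orP[] /eqP E; move: h0 h1' h3; rewrite E.
  rewrite expr0n add0r => /subr0_eq c3; rewrite expr0n mul0r add0r => /eqP.
  rewrite E mul0r sub0r oppr_eq0 mulf_eq0 negb_or in D0; case/andP: D0 => _ c0.
  rewrite mulf_eq0 expf_eq0 (negPf c0) /= => /eqP d0.
  rewrite d0 expr0n addr0 => /subr0_eq b3; right;
    rewrite !rmorph0 !mul0r add0r addr0.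
  by rewrite !exprMn -!rmorphXn /= b3 c3 rmorph1 !mul1r.
move=> a3; rewrite mulr0 add0r => /eqP.
rewrite E mul0r subr0 mulf_eq0 negb_or in D0; case/andP: D0 => a0 d0.
rewrite mulf_eq0 expf_eq0 (negPf d0) orbF /= => /eqP c0.
move: a3; rewrite c0 !expr0n addr0 add0r => /subr0_eq a3 /subr0_eq d3; left.
rewrite !rmorph0 !mul0r add0r addr0.
by rewrite !exprMn -!rmorphXn /= a3 d3 rmorph1 !mul1r.
Qed.

End PencilOverDomain.

Lemma eq_cubes (C : numClosedFieldType) (A : idomainType) (io : {rmorphism C
  -> A})
  (F G : A) : F ^+ 3 = G ^+ 3 -> exists2 z : C, z ^+ 3 = 1 & F = io z * G.
Proof.
move=> h; have [o [oE o3 _]] := cube_roots_of_unity C.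
have ioE : io o ^+ 2 + io o + 1 = 0.
  by rewrite -rmorphXn -rmorphD -(rmorph1 io) -rmorphD oE rmorph0.
have /eqP : (F - G) * (F - io o * G) * (F - io (o ^+ 2) * G) = 0.
  rewrite rmorphXn.
  apply: (@lincomb2 _ 1 _ _ (F * G * (io o * G - F) + G ^+ 3 * (1 - io o))
            _ _ _ _ h ioE); ring.
rewrite !mulf_eq0 => /orP[/orP[]|] /eqP /subr0_eq ->.
- by exists 1; rewrite ?expr1n // rmorph1 mul1r.
- by exists o.
- by exists (o ^+ 2); rewrite // -exprM mulnC exprM o3 expr1n.
Qed.

(** * Binary forms as polynomials in two variables *)

Section BinaryForms.
Variable R : realType.
Local Notation C := R[i].
Implicit Types (p q : {mpoly C[2]}) (f g h : C * C * C) (a b c d t x y z : C).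

Definition ev p x y : C := p.@[tnth [tuple x; y]].

Lemma ord2P (i : 'I_2) : i = ord0 \/ i = ord_max.
Proof. by case: i => [[|[|//]] ?]; [left|right]; apply: val_inj. Qed.

Lemma evX x y : ev (xvar R) x y = x.
Proof. by rewrite /ev mevalXU. Qed.

Lemma evY x y : ev (yvar R) x y = y.
Proof. by rewrite /ev mevalXU. Qed.

Lemma ev_lin_change a b c d p x y :
  ev (lin_change a b c d p) x y = ev p (a * x + b * y) (c * x + d * y).
Proof.
rewrite /ev /lin_change comp_mpoly_meval; apply: meval_eq => i.
by case: (ord2P i) => ->; rewrite mevalD !mevalZ !mevalXU.
Qed.

Definition mon2 (i j : nat) : 'X_{1..2} := (U_(ord0) *+ i + U_(ord_max) *+
  j)%MM.

Lemma mon2E i j : 'X_[mon2 i j] = xvar R ^+ i * yvar R ^+ j.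
Proof. by rewrite mpolyXD -!mpolyXn. Qed.

Lemma mnm2E (m : 'X_{1..2}) : m = mon2 (m ord0) (m ord_max).
Proof.
apply/mnmP => i; rewrite mnmDE !mulmnE !mnm1E.
by case: (ord2P i) => ->; rewrite -!val_eqE /=
  ?muln1 ?muln0 ?addn0 ?add0n mul1n.
Qed.

Lemma homogE (d : nat) p : p \is d.-homog ->
  p = \sum_(i < d.+1) p@_(mon2 i (d - i)) *: (xvar R ^+ i * yvar R ^+ (d - i)).
Proof.
move=> hp; apply/mpolyP => m; rewrite raddf_sum /=.
under eq_bigr => i _ do rewrite mcoeffZ -mon2E mcoeffX.
have mdegm : mdeg m = (m ord0 + m ord_max)%N.
  by rewrite mdegE !big_ord_recl big_ord0 addn0; congr (_ + m _)%N;
    apply: val_inj.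
have [md|md] := eqVneq (mdeg m) d; last first.
  rewrite (dhomog_nemf_coeff hp md) big1 // => i _; case: eqP => [e|]; last
    by rewrite mulr0.
  by rewrite e (dhomog_nemf_coeff hp md) mul0r.
have lt : (m ord0 < d.+1)%N by rewrite ltnS -md mdegm leq_addr.
rewrite (bigD1 (Ordinal lt)) //= big1 => [|i ne].
  have -> : mon2 (m ord0) (d - m ord0) = m.
    by rewrite [RHS]mnm2E -md mdegm addKn.
  by rewrite eqxx mulr1 addr0.
case: eqP => [e|]; last by rewrite mulr0.
case/eqP: ne; apply: val_inj; rewrite /= -e.
by rewrite mnmDE !mulmnE !mnm1E /= mul1n mul0n addn0.
Qed.

Lemma ev_homog (d : nat) p : p \is d.-homog ->
  forall x y, ev p x y = bform d (fun i => p@_(mon2 i (d - i))) x y.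
Proof.
move=> hp x y; rewrite {1}(homogE hp) /ev raddf_sum /=; apply: eq_bigr => i _.
by rewrite mevalZ mevalM !rmorphXn /= !mevalXU mulrA.
Qed.

(** Reduces equations between forms to identities between their values, where [ring] applies. *)
Lemma ev_inj (d : nat) p q : p \is d.-homog -> q \is d.-homog ->
  (forall x y, ev p x y = ev q x y) -> p = q.
Proof.
move=> hp hq e; rewrite (homogE hp) (homogE hq); apply: eq_bigr => i _;
  congr (_ *: _).
apply: (@bform_inj _ d (fun i => p@_(mon2 i (d - i))) (fun i
  => q@_(mon2 i (d - i)))) => [x y|].
  by rewrite -!ev_homog.
by rewrite -ltnS.
Qed.

Lemma homog_mon2 i j : xvar R ^+ i * yvar R ^+ j \is (i + j).-homog.
Proof. by rewrite -mon2E dhomogX /= mdegD !mdegMn !mdeg1 !mul1n. Qed.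

Lemma homog_lin_change (d : nat) (a b c e : C) p :
  p \is d.-homog -> lin_change a b c e p \is d.-homog.
Proof.
move=> hp; rewrite (homogE hp) /lin_change raddf_sum /=; apply: rpred_sum
  => i _.
rewrite comp_mpolyZ; apply: dhomogZ; rewrite rmorphM !rmorphXn /=
  !comp_mpolyXU /=.
have lid : (i <= d)%N by rewrite -ltnS.
have l1 (u v : C) : u *: xvar R + v *: yvar R \is 1.-homog.
  by apply: dhomogD; apply: dhomogZ; rewrite dhomogX /= mdeg1.
rewrite -[X in X.-homog](subnKC lid); apply: dhomogM.
  by rewrite -[X in X.-homog]mul1n; apply: dhomogMn; apply: l1.
by rewrite -[X in X.-homog]mul1n; apply: dhomogMn; apply: l1.
Qed.

Lemma sextic_ev p : p \is 6.-homog -> sextic (ev p).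
Proof.
move=> hp a b c d; exists (fun i => (lin_change a b c d p)@_(mon2 i (6 - i)))
  => x y.
by rewrite -ev_lin_change; apply: ev_homog; apply: homog_lin_change.
Qed.

Definition quad f : {mpoly C[2]} :=
  f.1.1 *: xvar R ^+ 2 + f.1.2 *: (xvar R * yvar R) + f.2 *: yvar R ^+ 2.

Lemma ev_quad f x y : ev (quad f) x y = qform f x y.
Proof.
rewrite /ev /quad !mevalD !mevalZ !rmorphXn /= mevalM -!/(ev _ x y) evX evY.
by rewrite /qform; ring.
Qed.

Lemma ev_cubes p q x y : ev (p ^+ 3 + q ^+ 3) x y = ev p x y ^+ 3 + ev q x y ^+
  3.
Proof. by rewrite /ev mevalD !rmorphXn. Qed.

Lemma quad_homog f : quad f \is 2.-homog.
Proof.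
have h2 := homog_mon2 2 0; have h11 := homog_mon2 1 1;
  have h02 := homog_mon2 0 2.
rewrite expr0 mulr1 in h2; rewrite expr0 mul1r in h02; rewrite !expr1 in h11.
by rewrite /quad !rpredD // dhomogZ.
Qed.

Lemma quadP p : p \is 2.-homog -> exists f, p = quad f.
Proof.
move=> hp; exists (p@_(mon2 2 0), p@_(mon2 1 1), p@_(mon2 0 2)).
apply: (ev_inj hp (quad_homog _)) => x y.
rewrite (ev_homog hp) ev_quad /qform /bform !big_ord_recl big_ord0 /= /bump /=.
by ring.
Qed.

Lemma quad_comb a b f g : a *: quad f + b *: quad g =
  quad (a * f.1.1 + b * g.1.1, a * f.1.2 + b * g.1.2, a * f.2 + b * g.2).
Proof.
apply: (@ev_inj 2) => [||x y]; rewrite ?quad_homog //.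
  by rewrite rpredD // dhomogZ // quad_homog.
rewrite [LHS]/ev mevalD !mevalZ -!/(ev _ x y) !ev_quad /qform /=.
by ring.
Qed.

Lemma quad_eq0 f : quad f = 0 -> f = 0.
Proof.
move=> h; have E x y : bform 2 (nth 0 [:: f.2; f.1.2;
  f.1.1]) x y = bform 2 (fun=> 0) x y.
  transitivity (ev (quad f) x y).
    by rewrite ev_quad /qform /bform !big_ord_recl big_ord0 /=; ring.
  by rewrite h /ev meval0 /bform big1 // => i _; rewrite !mul0r.
have e2 := bform_inj E (isT : (0 <= 2)%N); have e1 := bform_inj E (isT : (1 <=
  2)%N).
have e0 := bform_inj E (isT : (2 <= 2)%N); move: e0 e1 e2 => /=.
by case: f {h E} => [[? ?] ?] /= -> -> ->.
Qed.

Lemma quad0 : quad 0 = 0.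
Proof. by rewrite /quad /= !scale0r !addr0. Qed.

Lemma quad_inj : injective quad.
Proof.
move=> f g h; have : 1 *: quad f + (-1) *: quad g = 0
  by rewrite h scale1r scaleN1r subrr.
rewrite quad_comb => /quad_eq0 [] /eqP h0 /eqP h1 /eqP h2.
move: h0 h1 h2; rewrite !mul1r !mulN1r !subr_eq0.
by case: f g {h} => [[? ?] ?] [[? ?] ?] /= /eqP-> /eqP-> /eqP->.
Qed.

Lemma proportional_quad f g : proportional (quad f) (quad g) <-> cross f g = 0.
Proof.
split=> [[a [b [ab]]]|cE].
  rewrite quad_comb => /quad_eq0 [] h0 h1 h2.
  by congr (_, _, _) => /=; case: ab => nz; apply: (mulfI nz); rewrite mulr0;
    [apply: (@lincomb2 _ g.2 _ _ (- g.1.2) _ _ _ _ h1 h2)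
    |apply: (@lincomb2 _ f.1.2 _ _ (- f.2) _ _ _ _ h2 h1)
    |apply: (@lincomb2 _ g.1.1 _ _ (- g.2) _ _ _ _ h2 h0)
    |apply: (@lincomb2 _ f.2 _ _ (- f.1.1) _ _ _ _ h0 h2)
    |apply: (@lincomb2 _ g.1.2 _ _ (- g.1.1) _ _ _ _ h0 h1)
    |apply: (@lincomb2 _ f.1.1 _ _ (- f.1.2) _ _ _ _ h1 h0)]; ring.
have [->|f0] := eqVneq f 0.
  by exists 1, 0; rewrite oner_neq0 quad0 scaler0 scale0r addr0; split; [left|].
have [k ->] := cross_prop f0 cE.
exists k, (-1); split; first by right; rewrite oppr_eq0 oner_neq0.
rewrite quad_comb -[RHS]quad0; congr quad.
by rewrite /scale3 /=; congr (_, _, _); ring.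
Qed.

End BinaryForms.

(** * Representations and pencils *)

Section Pencils.
Variable R : realType.
Local Notation C := R[i].
Implicit Types (p q : {mpoly C[2]}) (f g h n : C * C * C) (a b c d t x y z : C).

Local Opaque quad.
Lemma cross_scale2 a b f g : cross (scale3 a f) (scale3 b g) =
  scale3 (a * b) (cross f g).
Proof. by rewrite /cross /scale3 /=; congr (_, _, _); ring. Qed.

Lemma cross_trans n h f : h != 0 -> cross n h = 0 -> cross h f = 0
  -> cross n f = 0.
Proof.
move=> h0 /crossC0 /(cross_prop h0) [k ->] /(cross_prop h0) [l ->].
by rewrite cross_scale2; rewrite /cross /scale3 /=; congr (_, _, _); ring.
Qed.

Definition cube_pair f g : {fset {mpoly C[2]}} :=
  [fset quad f ^+ 3; quad g ^+ 3]%fset.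

Lemma representationsP p S : representations p S <-> exists f g,
  [/\ cross f g != 0, p = quad f ^+ 3 + quad g ^+ 3 & S = cube_pair f g].
Proof.
split=> [[_ [_ [/quadP [f ->] /quadP [g ->] np pE SE]]]|[f [g [nc pE SE]]]].
  by exists f, g; split=> //; apply/eqP => /proportional_quad.
exists (quad f), (quad g); split=> //; try exact: quad_homog.
by move/proportional_quad/eqP; apply/negP.
Qed.

Lemma fset2_eq (K : choiceType) (u v u' v' : K) :
  u' = u /\ v' = v \/ u' = v /\ v' = u -> [fset u; v]%fset = [fset u'; v']%fset.
Proof. by case=> [] [-> ->] //; rewrite fsetUC. Qed.

Lemma imfset2_cancel (K : choiceType) (k k' : K -> K) (u v : K) :
  k' (k u) = u -> k' (k v) = v -> (k' @` (k @` [fset u; v]) = [fset u; v])%fset.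
Proof. by move=> ku kv; rewrite !imfset_fset2 ku kv. Qed.

Lemma fset2_mem (K : choiceType) (u v u' v' : K) :
  [fset u; v]%fset = [fset u'; v']%fset -> (u = u' \/ u = v') /\ (v = u' \/ v =
    v').
Proof.
by move=> e; split; apply/fset2P; rewrite -e; apply/fset2P; [left|right].
Qed.

(** Both pairs are bases of the same pencil; the transition matrix is invertible because its
    determinant relates the two cross products, so [cubes_in_pencil] applies. *)
Lemma cube_pair_same_cross p f g f' g' : cross f g != 0 -> cross f' g' != 0 ->
  p = quad f ^+ 3 + quad g ^+ 3 -> p = quad f' ^+ 3 + quad g' ^+ 3 ->
  cross (cross f g) (cross f' g') = 0 -> cube_pair f g = cube_pair f' g'.
Proof.
move=> n0 n0' pE pE' cE; have [k kE] := cross_prop n0 cE.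
have k0 : k != 0.
  by apply: contraNneq n0' => k0; rewrite kE k0 /scale3 /= !mul0r.
have dE h : dot h (cross f' g') = 0 -> dot h (cross f g) = 0.
  move=> e; apply: (mulfI k0); rewrite mulr0 -[RHS]e kE /dot /scale3 /=; ring.
have [/dE df' /dE dg'] := dot_cross f' g'.
have [a [b fE]] := cross_span n0 df'; have [c [d gE]] := cross_span n0 dg'.
have D0 : a * d - b * c != 0.
  apply: contraNneq n0' => D0; rewrite fE gE.
  have -> : 0 = scale3 (a * d - b * c) (cross f g) by rewrite D0 /scale3 !mul0r.
  by rewrite /cross /scale3 /=; apply/eqP; congr (_, _, _); ring.
have free u v : u%:MP_[2] * quad f + v%:MP_[2] * quad g = 0 -> u = 0 /\ v = 0.
  rewrite !mul_mpolyC => uv; suff : ~ (u != 0 \/ v != 0).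
    by move=> /not_orP [] /negP/negPn/eqP -> /negP/negPn/eqP ->.
  by move=> nz; case/eqP: n0; apply/proportional_quad; exists u, v.
have fE' : quad f' = a%:MP_[2] * quad f + b%:MP_[2] * quad g.
  by rewrite !mul_mpolyC quad_comb fE.
have gE' : quad g' = c%:MP_[2] * quad f + d%:MP_[2] * quad g.
  by rewrite !mul_mpolyC quad_comb gE.
apply: fset2_eq.
exact: (cubes_in_pencil (io := @mpolyC 2 C) free D0 fE' gE' (etrans (esym pE)
  pE')).
Qed.

Lemma eq_quad_cubes f g : quad f ^+ 3 = quad g ^+ 3 -> exists z, f = scale3 z g.
Proof.
move=> /(@eq_cubes C _ (@mpolyC 2 C)) [z _ fE]; exists z.
apply: quad_inj; rewrite fE /= mul_mpolyC -[_ *: _]addr0 -(scale0r (quad g))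
  quad_comb.
by congr quad; rewrite /scale3; congr (_, _, _); ring.
Qed.

(** Forms with equal cubes are proportional, so f and g are multiples of f' and g' in some order. *)
Lemma cube_pair_cross f g f' g' : cross f g != 0 ->
  cube_pair f g = cube_pair f' g' -> cross (cross f g) (cross f' g') = 0.
Proof.
move=> n0 /fset2_mem [hf hg].
(* Equality of the sets does not exclude at once that f and g match the same form. *)
have same h z w : f = scale3 z h -> g = scale3 w h -> False.
  move=> fE gE; case/eqP: n0; rewrite fE gE cross_scale2.
  by rewrite /cross /scale3; congr (_, _, _) => /=; ring.
case: hf => /eq_quad_cubes [z fE]; case: hg => /eq_quad_cubes [w gE].
- by case: (same _ _ _ fE gE).
- by rewrite fE gE cross_scale2 /cross /scale3; congr (_, _, _) => /=; ring.
- by rewrite fE gE cross_scale2 /cross /scale3; congr (_, _, _) => /=; ring.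
- by case: (same _ _ _ fE gE).
Qed.

(** The list s holds one normal vector for each pencil that carries a representation, so the
    positions in s enumerate the representations. *)
Lemma N_is_pencils p (s : seq (C * C * C)) :
  {in s, forall n, n != 0} -> pairwise (fun n h => cross n h != 0) s ->
  {in s, forall n, exists f g, [/\ cross f g != 0,
     p = quad f ^+ 3 + quad g ^+ 3 & cross n (cross f g) = 0]} ->
  (forall f g, cross f g != 0 -> p = quad f ^+ 3 + quad g ^+ 3 ->
     exists2 n, n \in s & cross n (cross f g) = 0) ->
  N_is p (size s).
Proof.
move=> s0 sP sE sA.
(* The membership premise lets [choice] yield a total function; off s the empty set is a dummy
   witness. *)
have ex n : exists S, n \in s -> exists f g, [/\ cross f g != 0,
     p = quad f ^+ 3 + quad g ^+ 3, cross n (cross f g) = 0 & S =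
       cube_pair f g].
  case: (boolP (n \in s)) => [/sE [f [g [? ? ?]]]|_]; last by exists fset0.
  by exists (cube_pair f g) => _; exists f, g.
have [S SP] := choice ex.
pose T i := S (nth 0 s i).
have repE : representations p = (T @` `I_(size s))%classic.
  apply/seteqP; split=> [U /representationsP [f [g [n0 pE ->]]]|U [i lti <-]].
    have [n ns cE] := sA f g n0 pE.
    exists (index n s); first by rewrite /= index_mem.
    have [f' [g' [n0' pE' cE' SE]]] := SP n ns.
    rewrite /T (nth_index _ ns) SE; apply: (cube_pair_same_cross n0' n0 pE' pE).
    by apply: cross_trans (s0 n ns) _ cE; apply: crossC0.
  have [f [g [n0 pE _ SE]]] := SP _ (mem_nth 0 lti).
  by apply/representationsP; exists f, g.
rewrite /N_is repE; apply: inj_card_eq => i j /set_mem/= lti /set_mem/= ltj.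
have [f [g [n0 pE cE SE]]] := SP _ (mem_nth 0 lti).
have [f' [g' [n0' pE' cE' SE']]] := SP _ (mem_nth 0 ltj).
rewrite /T SE SE' => /(cube_pair_cross n0) h.
have cij : cross (nth 0 s i) (nth 0 s j) = 0.
  by apply: cross_trans n0 cE _; apply: cross_trans n0' h (crossC0 cE').
apply/eqP; case: ltngtP => // ij; exfalso.
  by move/(pairwiseP 0): sP => /(_ i j lti ltj ij); rewrite cij eqxx.
by move/(pairwiseP 0): sP => /(_ j i ltj lti ij); rewrite (crossC0 cij) eqxx.
Qed.

Lemma N_is_unique p k l : N_is p k -> N_is p l -> k = l.
Proof.
by move=> hk hl; apply/card_eq_II; apply: card_eq_trans hl; rewrite card_eq_sym.
Qed.

Lemma N_is3_distinct p : N_is p 3 -> exists S1 S2 S3,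
  [/\ representations p S1, representations p S2 & representations p S3] /\
  [/\ S1 <> S2, S1 <> S3 & S2 <> S3].
Proof.
case/eq_cardSP => S1 r1 /eq_cardSP [S2 [r2 n21] /eq_cardSP [S3 [[r3 n31] n32]
  _]].
exists S1, S2, S3; split; split=> // e.
- by apply: n21; rewrite e.
- by apply: n31; rewrite e.
- by apply: n32; rewrite e.
Qed.

(** * Invariance of the count under linear changes *)

Lemma lin_change_cancel p (a b c d a' b' c' d' : C) (k : nat) : p \is k.-homog
  ->
  a * a' + b * c' = 1 -> a * b' + b * d' = 0 ->
  c * a' + d * c' = 0 -> c * b' + d * d' = 1 ->
  lin_change a' b' c' d' (lin_change a b c d p) = p.
Proof.
move=> hp h1 h2 h3 h4; apply: (@ev_inj _ k) => [||x y] //.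
  by do 2! apply: homog_lin_change.
rewrite !ev_lin_change; congr ev.
  transitivity ((a * a' + b * c') * x + (a * b' + b * d') * y); first by ring.
  by rewrite h1 h2; ring.
transitivity ((c * a' + d * c') * x + (c * b' + d * d') * y); first by ring.
by rewrite h3 h4; ring.
Qed.

Lemma lin_change_comb (a b c d u v : C) p q :
  lin_change a b c d (u *: p + v *: q) =
  u *: lin_change a b c d p + v *: lin_change a b c d q.
Proof. by rewrite /lin_change comp_mpolyD !comp_mpolyZ. Qed.

Lemma lin_change0 (a b c d : C) : lin_change a b c d 0 = 0.
Proof. by rewrite /lin_change raddf0. Qed.

Lemma lin_change_cubes (a b c d : C) p q : lin_change a b c d (p ^+ 3 + q ^+
  3) =
  lin_change a b c d p ^+ 3 + lin_change a b c d q ^+ 3.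
Proof. by rewrite /lin_change comp_mpolyD !rmorphXn. Qed.

Lemma lin_change_cube (a b c d : C) p :
  lin_change a b c d (p ^+ 3) = lin_change a b c d p ^+ 3.
Proof. by rewrite /lin_change rmorphXn. Qed.
Local Opaque lin_change.

Lemma representations_lin_change p (a b c d a' b' c' d' : C) S :
  a * a' + b * c' = 1 -> a * b' + b * d' = 0 ->
  c * a' + d * c' = 0 -> c * b' + d * d' = 1 ->
  representations p S ->
  representations (lin_change a b c d p) (lin_change a b c d @` S)%fset.
Proof.
move=> h1 h2 h3 h4 [f [g [hf hg np pE SE]]].
exists (lin_change a b c d f), (lin_change a b c d g); split.
- exact: homog_lin_change.
- exact: homog_lin_change.
- move=> [u [v [uv e]]]; apply: np; exists u, v; split=> //.
  rewrite -(lin_change_cancel hf h1 h2 h3 h4) -(lin_change_cancel hg h1 h2 h3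
    h4).
  by rewrite -lin_change_comb e lin_change0.
- by rewrite pE lin_change_cubes.
- rewrite SE imfset_fset2; apply: fset2_eq.
  by left; split; apply: esym; apply: lin_change_cube.
Qed.

Lemma card_image_cancel (T U : Type) (A : set T) (k : T -> U) (k' : U -> T) :
  (forall u, A u -> k' (k u) = u) -> ((k @` A)%classic #= A)%card.
Proof.
move=> kK; apply: inj_card_eq => u v /set_mem uA /set_mem vA e.
by rewrite -(kK u uA) -(kK v vA) e.
Qed.

(** The inverse matrix gives the inverse map on representations: [repK] yields injectivity and
    [repK'] surjectivity. *)
Lemma N_is_lin_change p (a b c d : C) (k : nat) : p \is 6.-homog
  -> a * d - b * c != 0 ->
  N_is p k <-> N_is (lin_change a b c d p) k.
Proof.
move=> hp D0; pose D := a * d - b * c.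
pose a' := d / D; pose b' := - b / D; pose c' := - c / D; pose d' := a / D.
have h1 : a * a' + b * c' = 1 by rewrite /a' /c' /D; field.
have h2 : a * b' + b * d' = 0 by rewrite /b' /d' /D; field.
have h3 : c * a' + d * c' = 0 by rewrite /a' /c' /D; field.
have h4 : c * b' + d * d' = 1 by rewrite /b' /d' /D; field.
have h1' : a' * a + b' * c = 1 by rewrite /a' /b' /D; field.
have h2' : a' * b + b' * d = 0 by rewrite /a' /b' /D; field.
have h3' : c' * a + d' * c = 0 by rewrite /c' /d' /D; field.
have h4' : c' * b + d' * d = 1 by rewrite /c' /d' /D; field.
pose L := lin_change a b c d; pose L' := lin_change a' b' c' d'.
have repK q S : representations q S -> (L' @` (L @` S) = S)%fset.
  move=> [f [g [hf hg _ _ ->]]].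
  apply: imfset2_cancel.
    exact: (lin_change_cancel (dhomogMn 3 hf) h1 h2 h3 h4).
  exact: (lin_change_cancel (dhomogMn 3 hg) h1 h2 h3 h4).
have repK' q S : representations q S -> (L @` (L' @` S) = S)%fset.
  move=> [f [g [hf hg _ _ ->]]].
  apply: imfset2_cancel.
    exact: (lin_change_cancel (dhomogMn 3 hf) h1' h2' h3' h4').
  exact: (lin_change_cancel (dhomogMn 3 hg) h1' h2' h3' h4').
have repE : representations (L p) = ((fun S => L @` S)%fset @` representations
  p)%classic.
  apply/seteqP; split=> [S rS|_ [S rS <-]]; last exact:
    (representations_lin_change h1 h2 h3 h4 rS).
  exists (L' @` S)%fset; last exact: repK' rS.
  rewrite -(lin_change_cancel hp h1 h2 h3 h4).
  exact: (representations_lin_change h1' h2' h3' h4' rS).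
pose k' (S : {fset {mpoly C[2]}}) : {fset {mpoly C[2]}} := (L' @` S)%fset.
have card : (representations (L p) #= representations p)%card.
  rewrite repE; apply: (@card_image_cancel _ _ _ _ k') => S rS.
  exact: (repK p).
split=> h; rewrite /N_is; first exact: card_eq_trans card h.
by apply: card_eq_trans h; rewrite card_eq_sym.
Qed.
End Pencils.

(** * Counting representations *)

Section Counting.
Variable R : realType.
Local Notation C := R[i].
Implicit Types (p q : {mpoly C[2]}) (f g h n : C * C * C) (a b c d t x y z e :
  C).
Local Opaque quad lin_change.

Lemma evD p q x y : ev (p + q) x y = ev p x y + ev q x y.
Proof. exact: mevalD. Qed.

Lemma evZ a p x y : ev (a *: p) x y = a * ev p x y.
Proof. exact: mevalZ. Qed.

Lemma evM p q x y : ev (p * q) x y = ev p x y * ev q x y.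
Proof. exact: mevalM. Qed.

Lemma evXn p (k : nat) x y : ev (p ^+ k) x y = ev p x y ^+ k.
Proof. exact: (rmorphXn (@meval 2 C (tnth [tuple x; y]))). Qed.
Local Opaque ev.

Lemma ev_B t x y : ev (B t) x y = Bt t x y.
Proof.
have hx k : ev (xvar R ^+ k) x y = x ^+ k by rewrite evXn evX.
have hy k : ev (yvar R ^+ k) x y = y ^+ k by rewrite evXn evY.
have comb p q r s : ev (p + t *: (q * r) + s) x y =
    ev p x y + t * (ev q x y * ev r x y) + ev s x y by rewrite !evD evZ evM.
apply: etrans (comb _ _ _ _) _; rewrite /Bt.
by congr (_ + _ * (_ * _) + _); [exact: hx|exact: hx|exact: hy|exact: hy].
Qed.

Lemma B_homog t : B t \is 6.-homog.
Proof.
have h6 := homog_mon2 R 6 0; have h33 := homog_mon2 R 3 3;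
  have h06 := homog_mon2 R 0 6.
rewrite expr0 mulr1 in h6; rewrite expr0 mul1r in h06.
rewrite /B; apply: dhomogD h06; apply: dhomogD h6 _; exact: dhomogZ.
Qed.
Local Opaque B.

Lemma cubes_homog f g : quad f ^+ 3 + quad g ^+ 3 \is 6.-homog.
Proof. by apply: dhomogD; apply: (dhomogMn 3 (quad_homog _)). Qed.

Lemma ev_rep p f g : p = quad f ^+ 3 + quad g ^+ 3 ->
  forall x y, ev p x y = qform f x y ^+ 3 + qform g x y ^+ 3.
Proof. by move=> pE x y; rewrite pE ev_cubes !ev_quad. Qed.

Lemma B_rep t f g : (forall x y, Bt t x y = qform f x y ^+ 3 + qform g x y ^+
  3) ->
  B t = quad f ^+ 3 + quad g ^+ 3.
Proof.
move=> H; apply: (ev_inj (B_homog t) (cubes_homog f g)) => x y.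
by rewrite ev_B H ev_cubes !ev_quad.
Qed.

Lemma rep_invol (P : C -> C -> C) f g :
  (forall x y, P x y = qform f x y ^+ 3 + qform g x y ^+ 3) ->
  involution_invariant P (cross f g).
Proof.
move=> PE x y; have [df dg] := dot_cross f g.
by rewrite !PE !qform_invol // !exprMn mulrDr.
Qed.

(** Without double roots every representation yields an involution with nonzero [delta], so it
    suffices to list those involutions and to represent each. *)
Lemma N_is_B t (s : seq (C * C * C)) : t ^+ 2 != 4 ->
  {in s, forall n, n != 0} -> pairwise (fun n h => cross n h != 0) s ->
  {in s, forall n, exists f g,
    [/\ forall x y, Bt t x y = qform f x y ^+ 3 + qform g x y ^+ 3,
        cross f g != 0 & cross n (cross f g) = 0]} ->
  (forall n, involution_invariant (Bt t) n -> delta n != 0 ->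
     exists2 m, m \in s & cross m n = 0) ->
  N_is (B t) (size s).
Proof.
move=> t2 s0 sP sE sA; apply: N_is_pencils => // [n /sE [f [g [fgE n0 cE]]]|f g
  n0 pE].
  by exists f, g; split=> //; apply: B_rep.
have fgE x y : Bt t x y = qform f x y ^+ 3 + qform g x y ^+ 3.
  by rewrite -ev_B (ev_rep pE).
apply: sA; first exact: rep_invol.
exact: delta_cross_neq0 (no_double_root_Bt t2) fgE n0.
Qed.

Lemma pairwise_map_in (T : eqType) (U : Type) (k : T
  -> U) (r : rel T) (r' : rel U)
  (s : seq T) : pairwise r s -> {in s &, forall u v, r u v -> r' (k u) (k v)} ->
  pairwise r' (map k s).
Proof.
move=> rs kr; rewrite pairwise_map.
by apply: (@sub_in_pairwise _ (mem s) r _ kr _ _ rs); apply/allP.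
Qed.

(* The involutions of the dihedral symmetry common to all B_t, and the
   additional ones of the octahedral sextic. *)
Let dih z : C * C * C := (- z, 0, z ^+ 2).
Let oct e z : C * C * C := (- z, e, - z ^+ 2).

Lemma triple_fst_neq0 (u v w : C) : u != 0 -> (u, v, w) != 0.
Proof. by apply: contra_neq => -[]. Qed.

(** * The count for each B_t *)

Lemma N_is_B_generic t : t ^+ 2 != 4 -> t ^+ 2 != - 50 -> t != 0
  -> N_is (B t) 3.
Proof.
move=> t2 t50 t0; have [o [oE o3 uo]] := cube_roots_of_unity C.
have o32 : (o ^+ 2) ^+ 3 = 1 by rewrite -exprM mulnC exprM o3 expr1n.
have zs z : z \in [:: 1; o; o ^+ 2] -> z ^+ 3 = 1.
  by rewrite !inE => /or3P[] /eqP -> //; rewrite expr1n.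
apply: (@N_is_B t [seq dih z | z <- [:: 1; o; o ^+ 2]] t2).
- by move=> _ /mapP [z /zs z3 ->]; rewrite triple_fst_neq0 // oppr_eq0
  cube_root_of_unity_neq0.
- apply: (pairwise_map_in uo).
  by move=> z w /zs z3 /zs w3 zw; apply: cross_dihedral.
- by move=> _ /mapP [z /zs z3 ->]; apply: Bt_rep_generic.
move=> n inv d0; case: (Bt_invol_classification oE t2 inv d0)
  => [[z z3 cE]|[tE]|].
- by exists (dih z) => //; apply: map_f; apply: cube_root_of_unityP.
- by rewrite tE eqxx in t0.
move=> [z [e [z3 e2 tE _]]]; case/eqP: t50; rewrite tE exprMn e2; ring.
Qed.

Lemma N_is_B_0 : N_is (B (0 : C)) 4.
Proof.
have t2 : (0 : C) ^+ 2 != 4 by rewrite expr0n eq_sym pnatr_eq0.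
have [o [oE o3 uo]] := cube_roots_of_unity C.
have o32 : (o ^+ 2) ^+ 3 = 1 by rewrite -exprM mulnC exprM o3 expr1n.
have zs z : z \in [:: 1; o; o ^+ 2] -> z ^+ 3 = 1.
  by rewrite !inE => /or3P[] /eqP -> //; rewrite expr1n.
apply: (@N_is_B 0 (rcons [seq dih z | z <- [:: 1; o; o ^+ 2]] (0, 1, 0)) t2).
- move=> n; rewrite mem_rcons inE => /orP[/eqP ->|/mapP [z /zs z3 ->]].
    by apply/eqP => /(congr1 (fun n : C * C * C => n.1.2)) /= /eqP;
      rewrite oner_eq0.
  by rewrite triple_fst_neq0 // oppr_eq0 cube_root_of_unity_neq0.
- rewrite pairwise_rcons; apply/andP; split.
    by apply/allP => _ /mapP [z /zs z3 ->]; apply: cross_dihedral_diagonal.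
  apply: (pairwise_map_in uo).
  by move=> z w /zs z3 /zs w3 zw; apply: cross_dihedral.
- move=> n; rewrite mem_rcons inE => /orP[/eqP ->|/mapP [z /zs z3 ->]].
    exact: Bt_rep_diagonal.
  exact: Bt_rep_generic.
move=> n inv d0; case: (Bt_invol_classification oE t2 inv d0)
  => [[z z3 cE]|[_ cE]|].
- exists (dih z) => //; rewrite mem_rcons inE; apply/orP; right.
  by apply: map_f; apply: cube_root_of_unityP.
- by exists (0, 1, 0) => //; rewrite mem_rcons inE eqxx.
move=> [z [e [_ e2 tE _]]]; exfalso; move/eqP: tE.
rewrite eq_sym mulf_eq0 pnatr_eq0 /= => /eqP e0; move/eqP: e2.
by rewrite e0 expr0n eq_sym oppr_eq0 pnatr_eq0.
Qed.

Lemma N_is_B_octahedral e : e ^+ 2 = - 2 -> N_is (B (5 * e)) 6.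
Proof.
move=> e2; have t2 : (5 * e) ^+ 2 != 4.
  rewrite exprMn e2 -subr_eq0 (_ : _ - _ = - 54%:R); last ring.
  by rewrite oppr_eq0 pnatr_eq0.
have e0 : e != 0.
  by apply: contra_eq_neq e2 => ->; rewrite expr0n eq_sym oppr_eq0 pnatr_eq0.
have [o [oE o3 uo]] := cube_roots_of_unity C.
have o32 : (o ^+ 2) ^+ 3 = 1 by rewrite -exprM mulnC exprM o3 expr1n.
have zs z : z \in [:: 1; o; o ^+ 2] -> z ^+ 3 = 1.
  by rewrite !inE => /or3P[] /eqP -> //; rewrite expr1n.
apply: (@N_is_B _ ([seq dih z | z <- [:: 1; o; o ^+ 2]] ++
                   [seq oct e z | z <- [:: 1; o; o ^+ 2]]) t2).
- by move=> n; rewrite mem_cat => /orP[] /mapP [z /zs z3 ->];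
    rewrite triple_fst_neq0 // oppr_eq0 cube_root_of_unity_neq0.
- rewrite pairwise_cat; apply/and3P; split.
  + apply/allrelP => _ _ /mapP [z /zs z3 ->] /mapP [w /zs w3 ->].
    exact: cross_dihedral_octahedral.
  + apply: (pairwise_map_in uo).
    by move=> z w /zs z3 /zs w3 zw; apply: cross_dihedral.
  + apply: (pairwise_map_in uo).
    by move=> z w _ _ zw; apply: cross_octahedral.
- move=> n; rewrite mem_cat => /orP[] /mapP [z /zs z3 ->].
    exact: Bt_rep_generic.
  exact: Bt_rep_octahedral.
move=> n inv d0; case: (Bt_invol_classification oE t2 inv d0)
  => [[z z3 cE]|[tE]|].
- exists (dih z) => //; rewrite mem_cat; apply/orP; left.
  by apply: map_f; apply: cube_root_of_unityP.
- by move/eqP: tE; rewrite mulf_eq0 pnatr_eq0 (negPf e0).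
move=> [z [e' [z3 _ tE cE]]]; exists (oct e z).
  rewrite mem_cat; apply/orP; right.
  by apply: map_f; apply: cube_root_of_unityP.
(* The value t = 5 e fixes the sign of the square root of - 2. *)
suff -> : e = e' by [].
have five : (5 : C) != 0 by rewrite pnatr_eq0.
exact: (mulfI five tE).
Qed.

(** Here B_t is the square of a cubic with three distinct roots. The Jacobian of f and g is a
    quadratic form vanishing at all three, so it is 0, and with it [cross f g]. *)
Lemma N_is_B_square t : t ^+ 2 = 4 -> N_is (B t) 0.
Proof.
move=> t2; rewrite /N_is II0 card_eq0; apply/eqP/seteqP; split=> // S.
move=> /representationsP [f [g [n0 pE _]]].
have fgE x y : Bt t x y = qform f x y ^+ 3 + qform g x y ^+ 3.
  by rewrite -ev_B (ev_rep pE).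
have three : (3 : C) != 0 by rewrite pnatr_eq0.
have two : (2 : C) != 0 by rewrite pnatr_eq0.
have root_jac z : z ^+ 3 = - t / 2 ->
    (cross f g).2 * z ^+ 2 - 2 * (cross f g).1.2 * z + (cross f g).1.1 = 0.
  move=> z3.
  (* The coefficients of h (x + z y, y). *)
  pose sh h : C * C * C := (h.1.1, h.1.2 + 2 * z * h.1.1, qform h z 1).
  have H x y : bform 6 (Bt_coefs t 1 z 0 1) x y = qform (sh f) x y ^+ 3 +
    qform (sh g) x y ^+ 3.
    by rewrite -Bt_subst fgE /qform /sh /qform /=; congr (_ ^+ 3 + _ ^+ 3);
      ring.
  have tE : t = - 2 * z ^+ 3 by rewrite z3; field.
  have z6 : z ^+ 6 = 1.
    rewrite (_ : 6%N = 3 * 2)%N // exprM z3.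
    apply: (mulfI (mulf_neq0 two two)); transitivity (t ^+ 2); first by field.
    by rewrite t2; ring.
  have := cubes_double_root H; rewrite /Bt_coefs /= => E; rewrite -[RHS]E.
  - by rewrite /cross /sh /qform /=; ring.
  - by apply: (@lincomb1 _ (-1) _ _ _ _ z6); rewrite tE; ring.
  - by rewrite tE; ring.
have [o [oE o3 _]] := cube_roots_of_unity C.
pose z : C := 3.-root (- t / 2); have z3 : z ^+ 3 = - t / 2 by rewrite rootCK.
have t0 : t != 0 by apply: contra_eq_neq t2 => ->;
  rewrite expr0n eq_sym pnatr_eq0.
have z0 : z != 0 by rewrite rootC_eq0 // mulf_neq0 ?oppr_eq0 ?invr_eq0.
have zo3 : (z * o) ^+ 3 = - t / 2 by rewrite exprMn o3 mulr1.
have zoo3 : (z * o ^+ 2) ^+ 3 = - t / 2 by rewrite exprMn -exprM mulnC exprM o3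
  expr1n mulr1.
have := root_jac _ zoo3; have := root_jac _ zo3; have := root_jac _ z3.
case: (cross f g) n0 => [[n_0 n_1] n_2] /= n0 j0 j1 j2.
(* Sums over the three roots weighted by cube roots of unity isolate first n_0, then n_1. *)
have e0 : n_0 = 0.
  have J := congr2 +%R (congr2 +%R j0 j1) j2; apply: (mulfI three).
  by apply: (@lincomb2 _ 1 _ _ (2 * n_1 * z - n_2 * z ^+ 2 * (o ^+ 2 - o +
    1)) _ _ _ _ J oE); ring.
have e1 : n_1 = 0.
  have J := congr2 +%R (congr2 +%R j0 (congr1 ( *%R (o ^+
    2)) j1)) (congr1 ( *%R o) j2).
  apply: (mulfI (mulf_neq0 three (mulf_neq0 two z0))).
  by apply: (@lincomb2 _ (-1) _ _ (n_2 * z ^+ 2 * (o ^+ 3 - o + 1) -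
    4 * n_1 * z * (o - 1) + n_0) _ _ _ _ J oE); ring.
have e2 : n_2 = 0.
  apply: (mulfI (expf_neq0 2 z0)); rewrite mulr0 -[RHS]j0 e0 e1; ring.
by case/eqP: n0; rewrite e0 e1 e2.
Qed.

(** * Sextics with exactly three representations *)

Lemma N_is3_no_double_root p : p \is 6.-homog -> N_is p 3
  -> no_double_root (ev p).
Proof.
move=> hp N3 a b c d e D0 H; apply: contraT; rewrite negb_or !negbK
  => /andP[/eqP e0 /eqP e1].
have /N_is3_distinct [S1 [S2 [_ [[r1 r2 _] [S12 _ _]]]]] :
  N_is (lin_change a b c d p) 3 by apply/(N_is_lin_change 3 hp D0).
case: S12; move: r1 r2 => /representationsP [f [g [n0 pE ->]]].
move=> /representationsP [f' [g' [n0' pE' ->]]].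
apply: (cube_pair_same_cross n0 n0' pE pE').
(* This vector depends only on the sextic, so both pencils have a normal vector parallel to it and
   coincide. *)
pose m : C * C * C := if e 2 == 0 then (0, 0, 1) else (0, - 2 * e 2, e 3).
have m0 : m != 0.
  rewrite /m; case: (eqVneq (e 2) 0) => [_|e2]; apply/eqP.
    by move/(congr1 (fun n : C * C * C => n.2)) => /= /eqP; rewrite oner_eq0.
  move/(congr1 (fun n : C * C * C => n.1.2)) => /= /eqP.
  by rewrite mulf_eq0 oppr_eq0 pnatr_eq0 (negPf e2).
have key h k : cross h k != 0 -> lin_change a b c d p = quad h ^+ 3 + quad k ^+
  3 ->
    cross m (cross h k) = 0.
  move=> hk0 hkE; apply: (cubes_double_root_cross hk0 _ e0 e1) => x y.
  by rewrite -H -ev_lin_change (ev_rep hkE).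
exact: cross_trans m0 (crossC0 (key _ _ n0 pE)) (key _ _ n0' pE').
Qed.

(** Unless some pair of the three involutions gives the normal form, all pairs have trace 0, and
    [three_commuting] makes p vanish. *)
Lemma N_is3_normal_form p : p \is 6.-homog -> N_is p 3 ->
  exists a b c d e0 e3 e6 : C, [/\ a * d - b * c != 0, e0 != 0, e6 != 0 &
      forall x y, ev p (a * x + b * y) (c * x + d * y) =
        e0 * y ^+ 6 + e3 * x ^+ 3 * y ^+ 3 + e6 * x ^+ 6].
Proof.
move=> hp N3; have np := N_is3_no_double_root hp N3; have sp := sextic_ev hp.
have [S1 [S2 [S3 [[r1 r2 r3] [S12 S13 S23]]]]] := N_is3_distinct N3.
move: r1 r2 r3 S12 S13 S23.
move=> /representationsP [f1 [g1 [n1 E1 ->]]] /representationsP [f2 [g2 [n2 E2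
  ->]]].
move=> /representationsP [f3 [g3 [n3 E3 ->]]] S12 S13 S23.
have i1 := rep_invol (ev_rep E1); have d1 := delta_cross_neq0 np (ev_rep E1) n1.
have i2 := rep_invol (ev_rep E2); have d2 := delta_cross_neq0 np (ev_rep E2) n2.
have i3 := rep_invol (ev_rep E3); have d3 := delta_cross_neq0 np (ev_rep E3) n3.
have c12 : cross (cross f1 g1) (cross f2 g2) != 0.
  by apply/eqP => e; apply: (S12 (cube_pair_same_cross n1 n2 E1 E2 e)).
have c13 : cross (cross f1 g1) (cross f3 g3) != 0.
  by apply/eqP => e; apply: (S13 (cube_pair_same_cross n1 n3 E1 E3 e)).
have c23 : cross (cross f2 g2) (cross f3 g3) != 0.
  by apply/eqP => e; apply: (S23 (cube_pair_same_cross n2 n3 E2 E3 e)).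
case: (two_involutions sp np d1 d2 i1 i2 c12) => [t12|[_ nf]]; last exact: nf.
case: (two_involutions sp np d1 d3 i1 i3 c13) => [t13|[_ nf]]; last exact: nf.
case: (two_involutions sp np d2 d3 i2 i3 c23) => [t23|[_ nf]]; last exact: nf.
have homP k x y : ev p (k * x) (k * y) = k ^+ 6 * ev p x y.
  by rewrite !(ev_rep E1) /qform; ring.
have p0 := three_commuting i1 i2 i3 d1 d2 d3 homP t12 t13 t23.
(* The zero form violates [no_double_root], already in the original coordinates. *)
have z0 x y : ev p (1 * x + 0 * y) (0 * x + 1 * y) = bform 6 (fun=> 0) x y.
  by rewrite p0 bform6E; ring.
have D1 : (1 * 1 - 0 * 0 : C) != 0 by rewrite mulr1 mulr0 subr0 oner_neq0.
by have := np _ _ _ _ _ D1 z0; rewrite eqxx.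
Qed.

Lemma N_is3_similar_B p : p \is 6.-homog -> N_is p 3 ->
  exists t, similar_forms p (B t).
Proof.
move=> hp N3.
have [a [b [c [d [e0 [e3 [e6 [D0 e00 e60 H]]]]]]]] := N_is3_normal_form hp N3.
have [r [s [t [r0 s0 nf]]]] := Bt_normal_form e3 e00 e60.
exists t, (a * r), (b * s), (c * r), (d * s); split.
  rewrite (_ : _ - _ = r * s * (a * d - b * c)); last ring.
  by rewrite !mulf_neq0.
apply: (ev_inj (B_homog t) (homog_lin_change _ _ _ _ hp)) => x y.
by rewrite ev_B ev_lin_change -nf -H; congr ev; ring.
Qed.

End Counting.

Theorem theorem5p5 (R : realType) :
  (forall p : {mpoly R[i][2]}, p \is 6.-homog ->
     (N_is p 3 <->
      exists t : R[i],
        t \notin [:: 2; - 2; 0; 5 * sqrtC (- 2); - (5 * sqrtC (- 2))]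
        /\ similar_forms p (B t)))
  /\ (N_is (B (2 : R[i])) 0 /\ N_is (B (- 2 : R[i])) 0)
  /\ N_is (B (0 : R[i])) 4
  /\ (N_is (B (5 * sqrtC (- 2) : R[i])) 6
      /\ N_is (B (- (5 * sqrtC (- 2)) : R[i])) 6).
Proof.
have s2 : sqrtC (- 2 : R[i]) ^+ 2 = - 2 by rewrite sqrtCK.
have Np2 : N_is (B (2 : R[i])) 0 by apply: N_is_B_square; ring.
have Nm2 : N_is (B (- 2 : R[i])) 0 by apply: N_is_B_square; ring.
have N0 := N_is_B_0 R.
have Np5 : N_is (B (5 * sqrtC (- 2) : R[i])) 6 by apply: N_is_B_octahedral.
have Nm5 : N_is (B (- (5 * sqrtC (- 2)) : R[i])) 6.
  by rewrite -mulrN; apply: N_is_B_octahedral; rewrite sqrrN.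
split=> // p hp; split=> [N3|[t [tN [a [b [c [d [D0 BE]]]]]]]].
  have [t sB] := N_is3_similar_B hp N3; exists t; split=> //.
  have NB : N_is (B t) 3.
    by case: sB => a [b [c [d [D0 ->]]]]; apply/(N_is_lin_change 3 hp D0).
  (* At each excluded value the count is known and differs from 3. *)
  rewrite !inE; apply/negP; do ![case/orP] => /eqP tE; rewrite tE in NB.
  - by have := N_is_unique NB Np2.
  - by have := N_is_unique NB Nm2.
  - by have := N_is_unique NB N0.
  - by have := N_is_unique NB Np5.
  - by have := N_is_unique NB Nm5.
apply/(N_is_lin_change 3 hp D0); rewrite -BE; move: tN.
rewrite !inE !negb_or => /and5P[t2 tm2 t0 t5 tm5]; apply: N_is_B_generic => //.
  apply/eqP => h; have : t ^+ 2 = 2 ^+ 2 by rewrite h; ring.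
  by case/eq_sqr => E; [rewrite E eqxx in t2|rewrite E eqxx in tm2].
apply/eqP => h; have : t ^+ 2 = (5 * sqrtC (- 2)) ^+ 2 by rewrite h exprMn s2;
  ring.
by case/eq_sqr => E; [rewrite E eqxx in t5|rewrite E eqxx in tm5].
Qed.
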